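(* Let $k \ge 6$ be an even integer, let $t=\lfloor (k-1)/2\rfloor$, and let $F$ be a graph with $p(F)\ge t+1$. Let $\mathcal{F}=\mathcal{C}_{\ge k}\cup\{F\}$, let $\mathcal{H}=\{F[S] : S \text{ is a vertex covering of } F\}$, and let $\mathcal{H}'=\{F-\{u,v\} : u \text{ is adjacent to } v \text{ in } F\}$. Then for all sufficiently large $n$, $$\mathrm{ex}_{2\text{-conn}}(n,\mathcal{F})=\mathrm{ex}(t,\mathcal{H})+t(n-t)+\ell$$ where $\ell\in\{0,1\}$. Moreover, if every graph in $\mathrm{EX}(t,\mathcal{H})$ contains a member of $\mathcal{H}'$ as a subgraph, then $\ell=0$.
   Context: All graphs are finite and simple. A graph is $\mathcal{G}$-free, for a family $\mathcal{G}$ of graphs, if it contains no member of $\mathcal{G}$ as a (not necessarily induced) subgraph. $\mathrm{ex}(n,\mathcal{G})$ is the maximum number of edges in an $n$-vertex $\mathcal{G}$-free graph, and $\mathrm{EX}(n,\mathcal{G})$ is the set of $n$-vertex $\mathcal{G}$-free graphs with exactly $\mathrm{ex}(n,\mathcal{G})$ edges. $\mathrm{ex}_{2\text{-conn}}(n,\mathcal{G})$ is the maximum number of edges among all $n$-vertex graphs that are 2-connected and $\mathcal{G}$-free. $\mathcal{C}_{\ge k}$ is the set of all cycles of length at least $k$. A vertex covering of $F$ is a set $S\subseteq V(F)$ such that $V(F)\setminus S$ is an independent set in $F$. If $F$ is bipartite, $p(F)$ is the smallest possible size of a color class among all proper 2-colorings of $F$; if $F$ is not bipartite, $p(F)=\infty$.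 ''Sufficiently large $n$'' means $n\ge n_0$ for some $n_0$ depending only on $k$ and $F$. *)

(* Defs.v *)
From HB Require Import structures.
From mathcomp Require Import all_boot.
From mathcomp Require Import boolp.

Set Implicit Arguments.
Unset Strict Implicit.
Unset Printing Implicit Defensive.

Record graph (T : finType) := Graph {
  edges : {set {set T}};
  edges_card2 : edges \subset [set e : {set _} | #|e| == 2]
}.

HB.instance Definition _ (T : finType) := [isSub for @edges T].
HB.instance Definition _ (T : finType) := [Finite of graph T by <:].

Definition adj (T : finType) (G : graph T) : rel T :=
  [rel x y | [set x; y] \in edges G].

(* Not necessarily induced: G contains a copy of H. *)
Definition contains (T U : finType) (G : graph T) (H : graph U) : Prop :=
  exists f : U -> T,
    injective f /\ (forall x y, adj H x y -> adj G (f x) (f y)).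

Definition family := forall T : finType, graph T -> Prop.

Definition free (Fam : family) (T : finType) (G : graph T) : Prop :=
  forall (U : finType) (H : graph U), Fam U H -> ~ contains G H.

Section Induced.
Variables (T : finType) (G : graph T) (S : {set T}).

Definition induced_edges : {set {set {x | x \in S}}} :=
  [set e : {set {x | x \in S}} | [set val x | x in e] \in edges G].

Lemma induced_card2 : induced_edges \subset [set e : {set _} | #|e| == 2].
Proof.
apply/subsetP => e; rewrite !inE => /(subsetP (edges_card2 G)).
by rewrite inE card_imset //; apply: val_inj.
Qed.

Definition induced : graph {x | x \in S} := Graph induced_card2.

End Induced.

Definition connected (T : finType) (G : graph T) : bool :=
  [forall x, forall y, connect (adj G) x y].

Definition two_connected (T : finType) (G : graph T) : bool :=
  [&& 2 < #|T|, connected G & [forall v, connected (induced G [set~ v])]].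

(* The n-vertex graphs are taken on the vertex set 'I_n.  A maximum over no
   graph at all is 0 by convention. *)
Definition ex (n : nat) (Fam : family) : nat :=
  \max_(G : graph 'I_n | `[< free Fam G >]) #|edges G|.

Definition EX (n : nat) (Fam : family) : {set graph 'I_n} :=
  [set G : graph 'I_n | `[< free Fam G >] && (#|edges G| == ex n Fam)].

Definition ex_2conn (n : nat) (Fam : family) : nat :=
  \max_(G : graph 'I_n | two_connected G && `[< free Fam G >]) #|edges G|.

Section Cycle.
Variable m : nat.

(* ordS is the cyclic successor on 'I_m; the cardinality condition only discards
   the degenerate loop when m = 1. *)
Definition cycle_edges : {set {set 'I_m}} :=
  [set e : {set 'I_m} | (#|e| == 2) && [exists i, e == [set i; ordS i]]].

Lemma cycle_card2 : cycle_edges \subset [set e : {set _} | #|e| == 2].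
Proof. by apply/subsetP => e; rewrite !inE => /andP[]. Qed.

Definition cycle_graph : graph 'I_m := Graph cycle_card2.

End Cycle.

(* A genuine cycle has length at least 3. *)
Inductive cycles_ge (k : nat) : family :=
| CyclesGe m of 3 <= m & k <= m : cycles_ge k (cycle_graph m).

Inductive adjoin (Fam : family) (T : finType) (F : graph T) : family :=
| AdjoinOld (U : finType) (G : graph U) of Fam U G : adjoin Fam F G
| AdjoinNew : adjoin Fam F F.

Definition independent (T : finType) (G : graph T) (A : {set T}) : bool :=
  [forall x in A, forall y in A, ~~ adj G x y].

Definition vertex_covering (T : finType) (G : graph T) (S : {set T}) : bool :=
  independent G (~: S).

Inductive covering_family (T : finType) (F : graph T) : family :=
| CoveringFamily S of vertex_covering F S : covering_family F (induced F S).

Inductive edge_deleted_family (T : finType) (F : graph T) : family :=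
| EdgeDeletedFamily u v of adj F u v :
    edge_deleted_family F (induced F (~: [set u; v])).

Definition proper_2coloring (T : finType) (G : graph T)
    (c : {ffun T -> bool}) : bool :=
  [forall x, forall y, adj G x y ==> (c x != c y)].

Definition color_class (T : finType) (G : graph T) (A : {set T}) : bool :=
  [exists c : {ffun T -> bool}, exists b : bool,
     proper_2coloring G c && (A == [set x | c x == b])].

(* None stands for infinity: a graph that is not bipartite has no color class of
   a proper 2-coloring, while a bipartite one always has (possibly empty). *)
Definition p (T : finType) (G : graph T) : option nat :=
  if [pick A | color_class G A] is Some A0
  then Some #|[arg min_(A < A0 | color_class G A) #|A|]|
  else None.

Definition le_inf (m : nat) (x : option nat) : bool :=
  if x is Some q then m <= q else true.

(* Main.v *)
Require Import Defs.
From mathcomp Require Import all_boot.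
From mathcomp Require Import zify.
From mathcomp Require Import boolp.

(** Write k = 2t + 2.  The lower bound is the join of an extremal graph on t
    vertices with n - t independent vertices.  For the upper bound, let G be
    2-connected and F-free with circumference less than k and more edges than
    the lower bound.  In an edge-maximal supergraph of G without a cycle of
    length at least k, the largest subgraph of minimum degree above t is a
    clique (Kopylov), hence has fewer than k vertices; so G arises from fewer
    than k vertices by adding vertices with at most t earlier neighbours, and
    by its number of edges all but boundedly many of them have exactly t.
    Paths of G have bounded length, so for n large many vertices share the
    same set A of t earlier neighbours.  A path outside A whose ends attach to
    distinct vertices of A then has at most two vertices.  Therefore, for
    every edge outside A, either one end has no other neighbour outside A and
    misses a vertex of A, or both ends are complete to A, which happens for at
    most one edge.  Charging the edges of the first kind to that end gives
    e(G) <= e(G[A]) + t(n - t) + 1, and in case of equality the exceptional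
    edge completes any F - {u, v} inside A to a copy of F. *)

Set Implicit Arguments.
Unset Strict Implicit.
Unset Printing Implicit Defensive.

(** * Disjoint paths and long cycles *)

Section Relations.

Variables (V : finType) (e : rel V).

Definition del (v : V) : rel V := [rel x y | [&& e x y, x != v & y != v]].

(** Connectedness is implied: any two vertices differ from some third vertex [v], so they are joined
    already in [del v]. *)
Definition two_conn : Prop :=
  2 < #|V| /\ forall v x y, x != v -> y != v -> connect (del v) x y.

(** [cycle] also accepts the empty list and an edge run back and forth; for [2 < k] these are short
    anyway, so only genuine cycles are excluded. *)
Definition no_long_cycle (k : nat) : Prop :=
  forall c, uniq c -> cycle e c -> size c < k.

(** A later visit to [X] or an earlier visit to [Y] cuts off a shorter path, so induction on the
    length applies. *)
Lemma path_between (r : rel V) (X Y : pred V) a b :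
  connect r a b -> X a -> Y b ->
  exists x l, [/\ X x, path r x l, uniq (x :: l), Y (last x l)
    & ~~ has X l /\ ~~ has Y (belast x l)].
Proof.
case/connectP => p; move: {2}(size p) (leqnn (size p)) => n.
elim: n a b p => [|n IH] a b p.
  by case: p => //= _ _ -> Xa Ya; exists a, [::].
move=> size_p path_p ->; case/shortenP: path_p => q path_q uniq_q sub_q Xa Yq.
have size_q : size q <= n.+1 by apply: leq_trans (uniq_leq_size _ sub_q) size_p; case/andP: uniq_q.
have [X_q|X_q] := boolP (has X q).
  case/hasP: X_q => z z_q Xz; case/splitPr: z_q path_q uniq_q Yq size_q => q1 q2.
  rewrite cat_path last_cat /= => /and3P[_ _ path_q2] _ Yq.
  rewrite size_cat /= => size_q.
  by apply: (IH z _ q2 _ path_q2 erefl Xz Yq); lia.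
have [Y_q|Y_q] := boolP (has Y (belast a q)); last by exists a, q.
case/hasP: Y_q => z z_q Yz; move: (lastI a q).
case/splitPr: z_q => -[|y q1] q2 /= [def_y def_q].
  by exists a, [::]; split; rewrite //= def_y.
apply: (IH a _ (rcons q1 z) _ _ erefl) => //; last by rewrite last_rcons.
- by move: size_q; rewrite def_q !(size_rcons, size_cat) /=; lia.
- move: path_q; rewrite def_q -cats1 -catA /= -cat_rcons cat_path.
  by case/andP.
Qed.

Hypothesis e_sym : symmetric e.

Lemma path_rev x l : path e x l -> path e (last x l) (rev (belast x l)).
Proof. by rewrite rev_path; apply: sub_path => y z /=; rewrite e_sym. Qed.

(** Run forwards through [a :: l], cross over along [c], run backwards through [b :: l'], and return
    to [a] along [d]. *)
Lemma glue_cycle a l b l' c d :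
  path e a l -> path e b l' -> path e (last a l) (rcons c (last b l')) ->
  path e b (rcons d a) -> cycle e (a :: l ++ c ++ rev (b :: l') ++ d).
Proof.
move=> path_l path_l' path_c path_d.
have -> : rev (b :: l') = last b l' :: rev (belast b l').
  by rewrite lastI rev_rcons.
have last_rev : last (last b l') (rev (belast b l')) = b.
  by case: l' {path_l' path_c} => //= y l'; rewrite rev_cons last_rcons.
rewrite /= rcons_cat cat_path path_l rcons_cat /= -cat_rcons rcons_cat.
by rewrite cat_path path_c last_rcons cat_path path_rev // last_rev path_d.
Qed.

Hypothesis e_irr : irreflexive e.
Hypothesis e_2c : two_conn.

Lemma del_path v x l : path (del v) x l -> x != v -> v \notin x :: l.
Proof.
elim: l x => [|y l IH] x /= => [_|/andP[/and3P[_ _ y_v] path_l] x_v].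
  by rewrite inE eq_sym.
by rewrite inE negb_or eq_sym x_v IH.
Qed.

(* Menger's theorem for two paths, keeping both ends of the given path r: by
   induction on r from its last vertex, after adding the last but one vertex
   of r to Y. *)
Lemma fan (X : pred V) x0 x' r (Y : pred V) y' :
  X x0 -> X x' -> x' != x0 -> ~~ has X r ->
  path e x0 r -> uniq (x0 :: r) ->
  Y (last x0 r) -> Y y' -> y' != last x0 r -> ~~ has Y (belast x0 r) ->
  exists a l b l',
  [/\ [/\ X a, X b & x0 \in [:: a; b]],
      path e a l /\ path e b l', uniq (a :: l ++ b :: l'),
      [/\ last a l = last x0 r & Y (last b l')]
    & [/\ ~~ has X l, ~~ has X l', ~~ has Y (belast a l)
        & ~~ has Y (belast b l')]].
Proof.
move=> X0 X' x'0 Xr; elim/last_ind: r Xr Y y' => [|r y0 IH] Xr Y y'.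
  (* With [r] empty, [x0] lies in both [X] and [Y] and is itself one of the two paths; the other one
     is found in the graph without [x0]. *)
  move=> _ _ /= Y0 Y' y'0 _.
  have [//|//|x [l [/andP[Xx x_0] path_l uniq_l Yl [Xl belast_l]]]] :=
    @path_between (del x0) [pred z | X z & z != x0] Y x' y'
      (e_2c.2 x0 x' y' x'0 y'0).
    by rewrite /= X'.
  have x0_l := del_path path_l x_0.
  exists x0, [::], x, l; split=> //=; first by rewrite inE eqxx.
  - by split=> //; apply: sub_path path_l => u v /andP[].
  - by rewrite x0_l.
  - split=> //; apply: contra Xl => /hasP[z z_l Xz]; apply/hasP; exists z => //=.
    by rewrite Xz; apply: contraNneq x0_l => <-; rewrite inE z_l orbT.
move: Xr; rewrite has_rcons negb_or => /andP[X_y0 Xr].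
rewrite rcons_path last_rcons belast_rcons -rcons_cons rcons_uniq.
move=> /andP[path_r e_y0] /andP[y0_r uniq_r] Yy0 Y' y'0 Y_r.
have p1_r : last x0 r \in x0 :: r by apply: mem_last.
have Yp1 : ~~ Y (last x0 r) by apply: contra Y_r => Yp; apply/hasP; exists (last x0 r).
have p1_y0 : last x0 r != y0 by apply: contraNneq y0_r => <-.
(* The shortened path ends in its own last vertex, now added to the targets, and [y0] serves as the
   second target. *)
have {IH} [||||] := IH Xr [pred z | Y z || (z == last x0 r)] y0 path_r uniq_r.
- by rewrite /= eqxx orbT.
- by rewrite /= Yy0.
- by rewrite eq_sym.
- apply/hasPn => z z_r /=; rewrite negb_or (hasPn Y_r) ?mem_belast //=.
  move: uniq_r; rewrite lastI rcons_uniq => /andP[p1_belast _].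
  by apply: contraNneq p1_belast => <-.
move=> a [l [b [l' [[Xa Xb x0_ab] [path_l path_l'] uniq_ll'
  [last_l Y'_l'] [Xl Xl' Y'l Y'l']]]]].
have al_bl' z : z \in a :: l -> z \notin b :: l'.
  move=> z_l; move: uniq_ll'; rewrite -cat_cons cat_uniq => /and3P[_ /hasPn dis _].
  by apply: contraTN z_l => /dis.
have [uniq_l uniq_l'] : uniq (a :: l) /\ uniq (b :: l').
  by move: uniq_ll'; rewrite -cat_cons cat_uniq => /and3P[-> _ ->].
have Yl' : Y (last b l').
  move: Y'_l' => /orP[//|/eqP last_l'].
  by have := al_bl' _ (mem_last a l); rewrite last_l -last_l' mem_last.
have Yal : ~~ has Y (a :: l).
  rewrite lastI has_rcons negb_or last_l Yp1 /=.
  by apply: contra Y'l; apply: sub_has => z /= ->.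
have {}Yl : ~~ has Y (belast a l).
  by apply: contra Y'l; apply: sub_has => z /= ->.
have {Y'l'}Y'l' : ~~ has Y (belast b l').
  by apply: contra Y'l'; apply: sub_has => z /= ->.
have path_ly : path e a (rcons l y0) by rewrite rcons_path path_l last_l e_y0.
have y0_l : y0 \notin a :: l.
  by apply: contra Yal => y0_l; apply/hasP; exists y0.
have uniq_ly : uniq (a :: rcons l y0) by rewrite -rcons_cons rcons_uniq y0_l.
have mem_ly v : (v \in a :: rcons l y0) = (v == y0) || (v \in a :: l).
  by rewrite -rcons_cons mem_rcons inE.
(* If the second path does not end in [y0], the first can be prolonged to [y0]. *)
have [last_l'|last_l'] := eqVneq (last b l') y0; last first.
  exists a, (rcons l y0), b, l'; split=> //.
  - rewrite -cat_cons cat_uniq uniq_ly uniq_l' andbT; apply/hasPn => z z_l'.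
    rewrite /= mem_ly negb_or; apply/andP; split; last first.
      by apply: contraTN z_l' => /al_bl'.
    apply: contraTneq z_l' => ->; rewrite lastI mem_rcons inE negb_or eq_sym last_l'.
    by apply: contra Y'l' => y0_l'; apply/hasP; exists y0.
  - by rewrite last_rcons.
  - by rewrite has_rcons negb_or X_y0 belast_rcons.
(* Now the second path occupies [y0]. Deleting [y0] does not disconnect the graph, so a path [m]
   avoiding [y0] leads to [Y] from the last point [z] at which it meets the two paths or [X]. *)
have [//|//|z [m [Tz path_m uniq_m Ym [Tm Y_m]]]] := @path_between (del y0)
  [pred z | (z \in (a :: l) ++ (b :: l')) && (z != y0) || X z] Y (last x0 r) y'
  (e_2c.2 _ _ _ p1_y0 y'0).
  by rewrite /= -cat_cons mem_cat -last_l mem_last last_l p1_y0.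
have z_y0 : z != y0.
  by move: Tz => /= /orP[/andP[]//|]; apply: contraTneq => ->.
have y0_m := del_path path_m z_y0.
have {}path_m : path e z m by apply: sub_path path_m => u v /andP[].
have m_ll' v : v \in m -> v \notin (a :: l) ++ (b :: l').
  move=> v_m; move/hasPn: Tm => /(_ v v_m) /=; rewrite negb_or negb_and negbK.
  case/andP => /orP[//|/eqP v_y0]; by rewrite -v_y0 inE v_m orbT in y0_m.
have Xm : ~~ has X m by apply: contra Tm; apply: sub_has => v /= ->; rewrite orbT.
have last_m : last z m != y0 by apply: contraNneq y0_m => <-; rewrite mem_last.
(* For [z] on the first path, that path is rerouted along [m], and the second one, ending in [y0],
   takes over the role of the first. *)
have [z_l|z_l] := boolP (z \in a :: l).
  case/splitPl: z_l path_l Xl uniq_l Yal m_ll' al_bl' => l1 l2 last_l1.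
  rewrite cat_path has_cat negb_or => /andP[path_l1 _] /andP[Xl1 _].
  rewrite -cat_cons cat_uniq has_cat negb_or.
  move=> /and3P[uniq_l1 _ _] /andP[Yl1 _] m_ll' al_bl'.
  exists b, l', a, (l1 ++ m); split=> //.
  - by split=> //; move: x0_ab; rewrite !inE orbC.
  - by rewrite cat_path path_l1 last_l1.
  - rewrite -cat_cons -[a :: _]cat_cons catA cat_uniq; apply/and3P; split.
    + rewrite cat_uniq uniq_l' uniq_l1 andbT; apply/hasPn => v v_l1.
      by apply: al_bl'; rewrite mem_cat v_l1.
    + apply/hasPn => v /m_ll'; rewrite !mem_cat !negb_or.
      by case/andP => /andP[-> _] ->.
    + by case/andP: uniq_m.
  - by rewrite last_cat last_l1.
  - rewrite has_cat negb_or Xl1 belast_cat has_cat negb_or last_l1 Y_m andbT.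
    split=> //; move: Yl1; rewrite [a :: l1]lastI has_rcons negb_or.
    by case/andP.
(* For [z] on the second path, rerouting it along [m] frees [y0] for the first. *)
have [z_l'|z_l'] := boolP (z \in b :: l').
  case/splitPl: z_l' path_l' Xl' uniq_l' Y'l' last_l' m_ll' al_bl' => l1 l2 last_l1.
  rewrite cat_path has_cat negb_or => /andP[path_l1 _] /andP[Xl1 _].
  rewrite -cat_cons cat_uniq belast_cat has_cat negb_or last_cat last_l1.
  move=> /and3P[uniq_l1 dis_l2 _] /andP[Yl1 _] last_l2 m_ll' al_bl'.
  have y0_l1 : y0 \notin b :: l1.
    have : y0 \in l2.
      case: (l2) last_l2 => /= [z_eq|y l3 <-]; last exact: mem_last.
      by rewrite z_eq eqxx in z_y0.
    by move/(hasPn dis_l2).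
  exists a, (rcons l y0), b, (l1 ++ m); split=> //.
  - by rewrite cat_path path_l1 last_l1.
  - rewrite -cat_cons -[b :: _]cat_cons catA cat_uniq; apply/and3P; split.
    + rewrite cat_uniq uniq_ly uniq_l1 andbT; apply/hasPn => v v_l1.
      rewrite /= mem_ly negb_or; apply/andP; split.
        by apply: contraNneq y0_l1 => <-.
      by apply: contraTN v_l1 => /al_bl'; rewrite mem_cat negb_or; case/andP.
    + apply/hasPn => v v_m; rewrite mem_cat mem_ly !negb_or.
      move: (m_ll' _ v_m); rewrite !mem_cat !negb_or => /and3P[-> -> _].
      by rewrite !andbT; apply: contraNneq y0_m => <-; rewrite inE v_m orbT.
    + by case/andP: uniq_m.
  - by rewrite last_rcons last_cat last_l1.
  - rewrite !has_cat has_rcons !negb_or X_y0 Xl Xl1 Xm belast_rcons belast_cat.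
    by rewrite has_cat negb_or Yl1 last_l1.
have Xz : X z by move: Tz; rewrite /= -cat_cons mem_cat (negbTE z_l) (negbTE z_l').
have zm_ll' v : v \in z :: m -> v \notin (a :: l) ++ (b :: l').
  by rewrite inE => /predU1P[->|/m_ll'//]; rewrite mem_cat negb_or z_l z_l'.
(* Here [m] starts in [X] off both paths and replaces the one that does not start at [x0]. *)
move: (x0_ab); rewrite !inE => /orP[] /eqP x0_eq.
  exists a, (rcons l y0), z, m; split=> //.
  - by rewrite inE x0_eq eqxx.
  - rewrite -cat_cons cat_uniq uniq_ly uniq_m andbT; apply/hasPn => v v_m.
    rewrite /= mem_ly negb_or; apply/andP; split.
      by apply: contraNneq y0_m => <-.
    by have := zm_ll' _ v_m; rewrite mem_cat negb_or => /andP[].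
  - by rewrite last_rcons.
  - by rewrite has_rcons negb_or X_y0 belast_rcons.
exists b, l', z, m; split=> //.
- by rewrite inE x0_eq eqxx.
- rewrite -cat_cons cat_uniq uniq_l' uniq_m andbT; apply/hasPn => v v_m.
  by have := zm_ll' _ v_m; rewrite mem_cat negb_or => /andP[].
Qed.

(** The path, closed up by the arc of [C] from [y] back to [x], is a cycle through all of [x], [l]
    and [y]. *)
Lemma cycle_detour C x l y :
  uniq C -> cycle e C -> x \in C -> y \in C -> path e x (rcons l y) ->
  uniq (x :: rcons l y) -> ~~ has [in C] l ->
  exists c, [/\ uniq c, cycle e c & size l + 2 <= size c].
Proof.
move=> uniq_C cycle_C /rot_to[i C' def_C] y_C path_l uniq_l l_C.
have memC : C =i x :: C' by move=> z; rewrite -def_C mem_rot.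
move: uniq_C cycle_C; rewrite -(rot_uniq i) -(rot_cycle i) def_C.
have y_C' : y \in C'.
  move: y_C uniq_l; rewrite memC inE => /predU1P[->|//].
  by rewrite /= mem_rcons mem_head.
case/splitPr: y_C' memC => c1 c2 memC {def_C}.
rewrite /cycle rcons_cat cat_path rcons_cons -[x :: c1 ++ _]cat_cons cat_uniq.
move=> /and3P[/andP[x_c1 _] /norP[_ dis_c2] uniq_c2] /andP[_ /andP[_ path_c2]].
exists (x :: rcons l y ++ c2); split.
- rewrite -cat_cons cat_uniq uniq_l; move: uniq_c2 => /= /andP[y_c2 uniq_c2].
  rewrite uniq_c2 andbT; apply/hasPn => z z_c2; rewrite inE mem_rcons inE !negb_or.
  apply/and3P; split.
  + by apply: contraNneq dis_c2 => <-; apply/hasP; exists z => //; rewrite inE eqxx.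
  + by apply: contraNneq y_c2 => <-.
  + apply: contra l_C => z_l; apply/hasP; exists z => //.
    by rewrite /= memC inE mem_cat inE z_c2 !orbT.
- rewrite /cycle rcons_cat cat_path last_rcons path_l //.
by rewrite /= size_cat size_rcons; lia.
Qed.

(* The fan lemma yields a cycle through both ends of the path, and between two
   consecutive visits to this cycle the path has fewer than k vertices. *)
Lemma path_size_bound k x s :
  2 < k -> no_long_cycle k -> path e x s -> uniq (x :: s) -> size s <= k * k.
Proof.
move=> k3 e_k path_s uniq_s; case: (leqP (size s) 2) => [|size_s]; first by nia.
(* Two disjoint paths between the first and the last edge of the given path, found by [fan] along
   its middle part, form the cycle together with these two edges. *)
have [C [uniq_C cycle_C x_C last_C]] :
    exists C, [/\ uniq C, cycle e C, x \in C & last x s \in C].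
  case: s path_s uniq_s size_s => // p1 s; case/lastP: s => // s pm.
  rewrite /= !rcons_path last_rcons size_rcons => /and3P[e_p1 path_s e_pm].
  rewrite inE negb_or mem_rcons inE negb_or mem_rcons inE negb_or rcons_uniq.
  move=> /andP[/and3P[x_p1 x_pm x_s] /andP[/andP[p1_pm p1_s] /andP[pm_s uniq_s]]] size_s.
  have p1s_last : p1 != last p1 s.
    case: (s) p1_s size_s => // z s' p1_s _.
    by apply: contraNneq p1_s => {1}->; apply: (mem_last z s').
  have [|||||||||| a [l [b [l' [[Xa Xb x0_ab] [path_l path_l'] uniq_ll'
    [last_l last_l'] _]]]]] := @fan (pred2 x p1) p1 x s (pred2 (last p1 s) pm) pm.
  - by rewrite /= eqxx orbT.
  - by rewrite /= eqxx.
  - by [].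
  - apply/hasPn => z z_s /=; rewrite negb_or.
    by apply/andP; split; [apply: contraNneq x_s | apply: contraNneq p1_s] => <-.
  - by [].
  - by rewrite /= p1_s.
  - by rewrite /= eqxx.
  - by rewrite /= eqxx orbT.
  - have: pm \notin p1 :: s by rewrite inE negb_or eq_sym p1_pm.
    by apply: contraNneq => ->; apply: mem_last.
  - apply/hasPn => z z_s; have: uniq (p1 :: s) by rewrite /= p1_s.
    rewrite lastI rcons_uniq => /andP[last_s _] /=; rewrite negb_or.
    apply/andP; split; first by apply: contraNneq last_s => <-.
    have: pm \notin p1 :: s by rewrite inE negb_or eq_sym p1_pm.
    by apply: contraNneq => <-; apply: mem_belast.
  have {last_l'} last_l' : last b l' = pm.
    move: last_l' => /orP[/eqP last_eq|/eqP//]; move: uniq_ll'.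
    rewrite -cat_cons cat_uniq => /and3P[_ /hasPn dis _].
    by have := dis _ (mem_last b l'); rewrite last_eq -last_l mem_last.
  have ab : a != b.
    by move: uniq_ll'; rewrite /= mem_cat inE !negb_or -!andbA => /and3P[].
  exists ((a :: l) ++ rev (b :: l')); split.
  - move: uniq_ll'; rewrite -cat_cons !cat_uniq rev_uniq.
    by move=> /and3P[-> dis ->]; rewrite andbT has_rev.
  - have := @glue_cycle a l b l' [::] [::]; rewrite cats0; apply=> //=.
      by rewrite last_l last_l' e_pm.
    rewrite andbT; move: Xa Xb ab => /= /orP[] /eqP -> /orP[] /eqP ->.
    + by rewrite eqxx.
    + by rewrite e_sym.
    + by rewrite e_p1.
    + by rewrite eqxx.
  - rewrite mem_cat mem_rev; move: Xa Xb ab => /= /orP[] /eqP -> /orP[] /eqP ->.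
    + by rewrite eqxx.
    + by rewrite inE eqxx.
    + by rewrite [X in _ || X]inE eqxx orbT.
    + by rewrite eqxx.
  - by rewrite mem_cat mem_rev -last_l' mem_last orbT.
have hits : count [in C] s <= k.
  rewrite -size_filter; apply: leq_trans (ltnW (e_k _ uniq_C cycle_C)).
  apply: uniq_leq_size => [|z]; last by rewrite mem_filter => /andP[].
  by rewrite filter_uniq //; case/andP: uniq_s.
(* Each visit to [C] accounts for the at most [k] steps since the previous one, by [cycle_detour];
   the induction restarts the path at its next visit. *)
suff: size s <= k * count [in C] s by nia.
move: {2}(size s) (leqnn (size s)) => n {hits size_s}.
elim: n x s path_s uniq_s x_C last_C => [|n IH] x s path_s uniq_s x_C last_C size_s.
  by move: size_s; lia.
case: s => // y s in path_s uniq_s last_C size_s *.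
have s_C : has [in C] (y :: s) by apply/hasP; exists (last y s) => //; apply: mem_last.
case/split_find: s_C path_s uniq_s last_C size_s => z l m z_C l_C.
rewrite cat_path last_cat last_rcons => /andP[path_l path_m] uniq_lm last_C.
rewrite !(size_cat, size_rcons, count_cat) => size_lm.
have uniq_l : uniq (x :: rcons l z).
  by move: uniq_lm; rewrite -cat_cons cat_uniq => /andP[].
have uniq_m : uniq (z :: m).
  by move: uniq_lm; rewrite -cats1 -catA cat1s -cat_cons cat_uniq => /and3P[].
have [c [uniq_c cycle_c size_c]] := cycle_detour uniq_C cycle_C x_C z_C path_l uniq_l l_C.
have size_l := leq_trans size_c (ltnW (e_k _ uniq_c cycle_c)).
have count_l : 0 < count [in C] (rcons l z).
  by rewrite -has_count; apply/hasP; exists z => //; rewrite mem_rcons mem_head.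
have size_m : size m <= n.
  by move: size_lm; rewrite addSn ltnS; apply: leq_trans; apply: leq_addl.
have IHm := IH z m path_m uniq_m z_C last_C size_m.
rewrite mulnDr; apply: leq_add IHm.
by apply: leq_trans (leq_pmulr _ count_l); rewrite addn2 in size_l; apply: ltnW.
Qed.

(** * Posa's lemma: cycles from the degrees of the ends of a path *)

Lemma path_rcons_rev u v d :
  path e u (rcons d v) -> path e v (rcons (rev d) u).
Proof.
by move/path_rev; rewrite last_rcons belast_rcons rev_cons.
Qed.

Lemma split_last_has (A : pred V) s :
  has A s -> exists s1 p s2, [/\ s = s1 ++ p :: s2, A p & ~~ has A s2].
Proof.
elim/last_ind: s => // s v IH; rewrite has_rcons.
have [Av _|Av /= /IH[s1 [p [s2 [-> Ap As2]]]]] := boolP (A v).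
  by exists s, v, [::]; rewrite cats1.
by exists s1, p, (rcons s2 v); rewrite rcons_cat has_rcons negb_or Av.
Qed.

Lemma split_first_has (A : pred V) s :
  has A s -> exists s1 p s2, [/\ s = s1 ++ p :: s2, A p & ~~ has A s1].
Proof. by case/split_find => p s1 s2 Ap As1; exists s1, p, s2; rewrite cat_rcons. Qed.

(** Shrink the pair until neither [A] nor [B] occurs between its members, then prefer a consecutive
    pair if there is one. A nonempty gap thus remains only if no two consecutive entries cross. In
    Posa's lemma, [A] and [B] are the neighbours of the last and the first vertex. *)
Lemma closest_crossing (A B : pred V) P L u M v R :
  P = L ++ u :: M ++ v :: R -> A u -> B v -> exists L' u' M' v' R',
  [/\ P = L' ++ u' :: M' ++ v' :: R', A u', B v',
      ~~ has A M' /\ ~~ has B M'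
    & M' = [::] \/ sorted (fun a b => ~~ (A a && B b)) P].
Proof.
move: {2}(size M) (leqnn (size M)) => n.
elim: n L u M v R => [|n IH] L u M v R size_M def_P.
  case: M size_M def_P => // _ def_P Au Bv.
  by exists L, u, [::], v, R; split=> //; left.
move=> Au Bv; have [A_M|A_M] := boolP (has A M).
  case/split_find: A_M def_P size_M => w M1 M2 Aw _ def_P.
  rewrite size_cat size_rcons => size_M.
  apply: (IH (L ++ u :: M1) w M2 v R) => //; last by rewrite def_P -!catA /= cat_rcons.
  by move: size_M; rewrite addSn ltnS; apply: leq_trans; apply: leq_addl.
have [B_M|B_M] := boolP (has B M).
  case/split_find: B_M def_P size_M A_M => w M1 M2 Bw _ def_P.
  rewrite size_cat size_rcons => size_M _.
  apply: (IH L u M1 w (M2 ++ v :: R)) => //; last by rewrite def_P -!catA cat_rcons.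
  by move: size_M; rewrite addSn ltnS; apply: leq_trans; apply: leq_addr.
have [P_sorted|P_sorted] := boolP (sorted (fun a b => ~~ (A a && B b)) P).
  by exists L, u, M, v, R; split=> //; right.
have [L' [u' [v' [R' [-> Au' Bv']]]]] :
    exists L' u' v' R', [/\ P = L' ++ u' :: v' :: R', A u' & B v'].
  elim: P P_sorted {IH def_P} => // w [//|w' P] IHP /=; rewrite negb_and negbK.
  case/orP => [/andP[Aw Bw']|/IHP[L' [u' [v' [R' [-> Au' Bv']]]]]].
    by exists [::], w, w', P.
  by exists (w :: L'), u', v', R'.
by exists L', u', [::], v', R'; split=> //; left.
Qed.

(** The successors of the [A]-entries are entries of [l] outside [B]. *)
Lemma count_no_crossing (A B : pred V) z l :
  path (fun a b => ~~ (A a && B b)) z l ->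
  count B l + count A (belast z l) <= size l.
Proof.
elim: l z => //= w l IH z /andP[AB /IH]; move: AB.
case: (A z) (B w) => [] [] //=; lia.
Qed.

(* Walk back from z to x, then jump to the first neighbour of x after z. *)
Lemma comb x s p z :
  path e x (rcons s p) -> uniq (x :: rcons s p) -> e x p -> z \in x :: s ->
  exists d, [/\ path e z (rcons d p), uniq (z :: rcons d p),
    {subset d <= x :: s} & {subset x :: filter (e x) s <= z :: d}].
Proof.
move=> path_s uniq_s e_xp z_s.
case/splitPl: z_s path_s uniq_s => s1 s2 last_s1 path_s uniq_s.
have [l [q [m [def_s2 e_xq l_x]]]] : exists l q m,
    [/\ rcons s2 p = l ++ q :: m, e x q & ~~ has (e x) l].
  by apply: split_first_has; rewrite has_rcons e_xp.
have def_p : last q m = p.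
  by move/(congr1 (last x)): def_s2; rewrite last_rcons last_cat.
have def_qm : q :: m = rcons (belast q m) p by rewrite lastI def_p.
have belast_s1 : z :: rev (belast x s1) = rev (x :: s1).
  by rewrite [x :: s1]lastI rev_rcons last_s1.
move: uniq_s; rewrite rcons_cat -cat_cons cat_uniq => /and3P[uniq_s1 dis uniq_s2].
have /andP[p_s2 _] : (p \notin s2) && uniq s2 by rewrite -rcons_uniq.
have /andP[p_m _] : (p \notin belast q m) && uniq (belast q m).
  by move: uniq_s2; rewrite -rcons_uniq -def_qm def_s2 cat_uniq => /and3P[].
exists (rev (belast x s1) ++ belast q m).
rewrite rcons_cat -def_qm; split.
- move: path_s; rewrite rcons_cat def_s2 !cat_path last_s1.
  move=> /and3P[path_s1 _ /= /andP[_ ->]]; rewrite andbT -{1}last_s1 path_rev //=.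
  rewrite -[last z _]/(last x (z :: rev (belast x s1))) belast_s1.
  by rewrite rev_cons last_rcons.
- rewrite -cat_cons belast_s1 cat_uniq rev_uniq uniq_s1.
  move: dis uniq_s2; rewrite def_s2 has_cat negb_or cat_uniq => /andP[_ dis] /and3P[_ _ ->].
  by rewrite andbT; apply: contra dis; apply: sub_has => v; rewrite /= mem_rev.
- move=> v; rewrite -cat_cons !mem_cat mem_rev => /orP[/mem_belast->//|v_m].
  apply/orP; right; have: v \in rcons s2 p.
    by rewrite def_s2 mem_cat def_qm mem_rcons inE v_m !orbT.
  rewrite mem_rcons inE => /predU1P[v_p|//].
  by rewrite -v_p v_m in p_m.
- move=> v; rewrite -cat_cons mem_cat belast_s1 mem_rev => v_s.
  have [//|v_s1 /=] := boolP (v \in x :: s1).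
  move: v_s; rewrite inE mem_filter mem_cat.
  have -> : v == x = false by apply: contraNF v_s1 => /eqP->; rewrite mem_head.
  have -> /= : v \in s1 = false by apply: contraNF v_s1 => v_s1; rewrite inE v_s1 orbT.
  case/andP => e_v v_s2; have: v \in rcons s2 p by rewrite mem_rcons inE v_s2 orbT.
  rewrite def_s2 mem_cat def_qm mem_rcons inE => /or3P[v_l|/eqP v_p|//].
    by case/hasP: l_x; exists v.
  by rewrite -v_p v_s2 in p_s2.
Qed.

(* The cycle runs through everything but M.  If M is nonempty, no neighbour of
   y immediately precedes a neighbour of x, which bounds the two degrees by
   the length of the cycle. *)
Lemma crossing_cycle x y s L u M v R :
  path e x s -> last x s = y -> uniq (x :: s) -> x :: s = L ++ u :: M ++ v :: R ->
  e y u -> e x v -> ~~ has (e y) M -> ~~ has (e x) M ->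
  M = [::] \/ sorted (fun a b => ~~ (e y a && e x b)) (x :: s) ->
  exists c, [/\ uniq c, cycle e c &
    minn (size s).+1 (count (e x) (x :: s) + count (e y) (x :: s))
      <= size c].
Proof.
move=> path_s last_y uniq_s def_s e_yu e_xv M_y M_x M_sorted.
have [L0 def_L] : exists L0, rcons L u = x :: L0.
  by case: L def_s => [|w L] [-> _]; [exists [::] | exists (rcons L u)].
have {}def_s : s = L0 ++ M ++ v :: R.
  by move: def_s; rewrite -cat_rcons def_L => -[].
have last_L0 : last x L0 = u by move/(congr1 (last x)): def_L; rewrite last_rcons.
have last_s : y = last v R by rewrite -last_y def_s !last_cat.
exists ((x :: L0) ++ rev (v :: R)); split.
- move: uniq_s; rewrite def_s -cat_cons !cat_uniq rev_uniq has_rev has_cat negb_or.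
  by move=> /and3P[-> /andP[_ ->] /and3P[_ _ ->]].
- move: path_s; rewrite def_s !cat_path /= => /and4P[path_L0 _ _ path_R].
  have := @glue_cycle x L0 v R [::] [::]; rewrite cats0; apply=> //=.
    by rewrite last_L0 -last_s e_sym e_yu.
  by rewrite e_sym e_xv.
case: M_sorted => [M0|sorted_s].
  by rewrite geq_min size_cat size_rev def_s M0 size_cat /= addSn leqnn.
rewrite geq_min; apply/orP; right.
rewrite def_s -cat_cons !count_cat.
move/negbTE: M_x; rewrite has_count lt0n => /negbFE/eqP->.
move/negbTE: M_y; rewrite has_count lt0n => /negbFE/eqP->.
rewrite !add0n size_cat size_rev addnACA.
move: sorted_s; rewrite [sorted _ _]/= def_s !cat_path => /and3P[sorted_L0 _].
case/andP=> _ sorted_R.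
(* On the left piece, [u] is a neighbour of [y] not counted by [belast], and the head [x], which is
   not its own neighbour, makes up for it. On the right piece [v] is the extra neighbour of [x], and
   the last vertex [y] is not its own neighbour. *)
apply: leq_add.
  have le_L0 := count_no_crossing sorted_L0.
  rewrite [count (e x) _]/= e_irr add0n.
  have -> : count (e y) (x :: L0) = count (e y) (belast x L0) + 1.
    by rewrite lastI -cats1 count_cat /= last_L0 e_yu.
  by rewrite addn1 addnS /= ltnS.
have le_R := count_no_crossing sorted_R.
rewrite [count (e x) _]/= e_xv addSn.
have -> : count (e y) (v :: R) = count (e y) (belast v R).
  by rewrite lastI -cats1 count_cat /= -last_s e_irr !addn0.
by rewrite /= ltnS.
Qed.

(* No neighbour of x comes after a neighbour of y.  The fan from the last
   neighbour of x to the first neighbour of y is closed up by a comb at either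
   end. *)
Lemma vine_cycle x y s :
  path e x s -> last x s = y -> uniq (x :: s) -> s != [::] ->
  (forall L u R, x :: s = L ++ u :: R -> e y u -> ~~ has (e x) R) ->
  exists c, [/\ uniq c, cycle e c &
    count (e x) (x :: s) + count (e y) (x :: s) <= size c].
Proof.
move=> path_s last_y uniq_s s_neq0 no_crossing.
have s_x : has (e x) s by case: (s) path_s s_neq0 => //= z s' /andP[->].
have e_xy : ~~ e x y.
  apply/negP => e_xy; have e_yx : e y x by rewrite e_sym.
  have y_s : y \in s by rewrite -last_y; case: (s) s_neq0 => //= z s' _; apply: mem_last.
  by have /hasPn/(_ y y_s) := no_crossing [::] x s erefl e_yx; rewrite e_xy.
(* Here [p] is the last neighbour of [x], and [pu] below is the first neighbour of [y]. The path
   splits into a part from [x] to [p], a middle part [r] from [p] to [pu], and a part [q2] up to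
   [y]. *)
have [s1 [p [s2 [def_s e_xp s2_x]]]] := split_last_has s_x.
have s2_neq0 : s2 != [::].
  by apply: contraNneq e_xy => s20; rewrite -last_y def_s s20 last_cat.
have last_s2 : last p s2 = y by rewrite -last_y def_s last_cat.
have p_y : has (e y) (p :: s2).
  case/lastP: s2 s2_neq0 last_s2 def_s {s2_x} => // s2 y' _; rewrite last_rcons => -> def_s.
  move: path_s; rewrite def_s cat_path /= rcons_path => /and4P[_ _ _ e_y].
  rewrite -[_ || _]/(has (e y) (p :: rcons s2 y)).
  by apply/hasP; exists (last p s2); rewrite 1?e_sym // -rcons_cons mem_rcons inE mem_last orbT.
have s1_y : ~~ has (e y) (x :: s1).
  apply/hasPn => u u_s1; apply/negP => e_yu.
  have [L [R def_L]] : exists L R, x :: s1 = L ++ u :: R.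
    by case/splitPr: u_s1 => L R; exists L, R.
  have := no_crossing L u (R ++ p :: s2); rewrite def_s -cat_cons def_L -catA.
  by move=> /(_ erefl e_yu); rewrite has_cat /= e_xp orbT.
have [q1 [pu [q2 [def_q e_ypu q1_y]]]] := split_first_has p_y.
have [r def_r] : exists r, p :: r = rcons q1 pu.
  by case: q1 def_q {q1_y} => [|w q1] [-> _]; [exists [::] | exists (rcons q1 pu)].
have def_s2 : s2 = r ++ q2 by move: def_q; rewrite -cat_rcons -def_r => -[].
have last_r : last p r = pu by move/(congr1 (last x)): def_r; rewrite last_rcons.
have belast_r : belast p r = q1.
  by move: def_r; rewrite lastI => /rcons_inj[].
have y_pu : y != pu by apply: contraTneq e_ypu => <-; rewrite e_irr.
have [q3 def_q2] : exists q3, q2 = rcons q3 y.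
  move: last_s2; rewrite def_s2 last_cat last_r.
  case/lastP: (q2) => [/= pu_y|q3 y']; first by rewrite pu_y eqxx in y_pu.
  by rewrite last_rcons => ->; exists q3.
have x_p : x != p by apply: contraTneq e_xp => <-; rewrite e_irr.
have def_P : x :: s = (x :: s1) ++ (p :: r) ++ q2 by rewrite def_s def_s2.
have path_X : path e x (rcons s1 p).
  by move: path_s; rewrite def_s -cat_rcons cat_path => /andP[].
have path_r : path e p r.
  by move: path_s; rewrite def_s cat_path /= def_s2 cat_path => /and4P[].
have path_Y : path e y (rcons (rev q3) pu).
  apply: path_rcons_rev; rewrite -def_q2 -last_r.
  by move: path_s; rewrite def_s cat_path /= def_s2 cat_path => /and4P[].
have uniq_X : uniq (x :: rcons s1 p).
  by move: uniq_s; rewrite def_s -cat_rcons -cat_cons cat_uniq => /andP[].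
have uniq_r : uniq (p :: r).
  by move: uniq_s; rewrite def_P cat_uniq => /and3P[_ _]; rewrite cat_uniq => /andP[].
have uniq_Y' : uniq (pu :: q2).
  by move: uniq_s; rewrite def_P def_r cat_rcons 2!cat_uniq => /and5P[].
have uniq_Y : uniq (y :: rcons (rev q3) pu).
  by rewrite -rcons_cons -rev_rcons -rev_cons rev_uniq -def_q2.
have X_s2 v : v \in s2 -> v \notin x :: rcons s1 p.
  move=> v_s2; move: uniq_s; rewrite def_s -cat_rcons -cat_cons cat_uniq.
  by case/and3P=> _ /hasPn dis _; apply: dis.
have Y_pre v : v \in (x :: s1) ++ q1 -> v \notin pu :: q2.
  move=> v_pre; move: uniq_s; rewrite def_P def_r cat_rcons catA cat_uniq.
  by case/and3P=> _ /hasPn dis _; apply: contraTN v_pre => /dis.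
have XY v : v \in x :: rcons s1 p -> v \in pu :: q2 -> v = p /\ v = pu.
  move=> v_X v_Y; rewrite -rcons_cons mem_rcons inE in v_X.
  case/predU1P: v_X => [v_p|v_X]; last first.
    by have := Y_pre v; rewrite v_Y mem_cat v_X => /(_ isT).
  split=> //; case: q1 def_r {q1_y def_q belast_r} Y_pre => [|w q1] /=.
    by rewrite v_p => -[].
  case=> <- _ /(_ p); rewrite -v_p v_Y -cat_cons mem_cat [X in _ || X]inE eqxx orbT.
  by move/(_ isT).
(* Two disjoint paths from the first part to the last part, one starting at [p] and one ending at
   [pu]. If [p = pu], one of them is trivial. *)
have [||||||||||a [l [b [l' [[Xa Xb p_ab] [path_l path_l'] uniq_ll' [last_l last_l']
  [Xl Xl' Yl Yl']]]]]] := @fan [in x :: rcons s1 p] p x r [in pu :: q2] y.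
- by rewrite /= -rcons_cons mem_rcons mem_head.
- by rewrite /= mem_head.
- by [].
- by apply/hasPn => v v_r; apply: X_s2; rewrite def_s2 mem_cat v_r.
- by [].
- by [].
- by rewrite last_r /= mem_head.
- by rewrite /= def_q2 inE mem_rcons mem_head orbT.
- by rewrite last_r.
- by rewrite belast_r; apply/hasPn => v v_q1; apply: Y_pre; rewrite mem_cat v_q1 orbT.
rewrite last_r in last_l; set w := last b l' in last_l' *.
have /and3P[uniq_l /hasPn dis_l uniq_l'] :
    [&& uniq (a :: l), ~~ has [in a :: l] (b :: l') & uniq (b :: l')].
  by rewrite -cat_uniq.
have w_pu : w != pu.
  apply/eqP => w_pu; have := dis_l _ (mem_last b l').
  by rewrite /= -/w w_pu -last_l mem_last.
have ab : a != b.
  by apply: contraTneq (dis_l _ (mem_head b l')) => <-; rewrite /= mem_head.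
have X_l v : v \in a :: l -> v \in x :: rcons s1 p -> v = a.
  rewrite inE => /predU1P[//|v_l] v_X.
  by have := hasPn Xl v v_l; rewrite /= v_X.
have X_l' v : v \in b :: l' -> v \in x :: rcons s1 p -> v = b.
  rewrite inE => /predU1P[//|v_l] v_X.
  by have := hasPn Xl' v v_l; rewrite /= v_X.
have Y_l v : v \in a :: l -> v \in pu :: q2 -> v = pu.
  rewrite lastI mem_rcons inE last_l => /predU1P[//|v_l] v_Y.
  by have := hasPn Yl v v_l; rewrite /= v_Y.
have Y_l' v : v \in b :: l' -> v \in pu :: q2 -> v = w.
  rewrite lastI mem_rcons inE => /predU1P[//|v_l] v_Y.
  by have := hasPn Yl' v v_l; rewrite /= v_Y.
have w_Y : w \in y :: rev q3.
  move: last_l'; rewrite /= inE (negbTE w_pu) def_q2 /= mem_rcons.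
  by rewrite !inE mem_rev.
have [dY [path_dY uniq_dY dY_sub dY_y]] := comb path_Y uniq_Y e_ypu w_Y.
(* One of [a], [b] is [p]. The comb runs from the other one to [p], so it is reversed when [b] is
   [p]. *)
have [D [path_D uniq_D D_sub D_x]] : exists D, [/\ path e b (rcons D a),
    uniq (b :: rcons D a), {subset D <= x :: s1}
    & {subset x :: filter (e x) s1 <= a :: b :: D}].
  have X_p v : v \in x :: rcons s1 p -> v != p -> v \in x :: s1.
    by rewrite -rcons_cons mem_rcons inE => /predU1P[->|//]; rewrite eqxx.
  move: p_ab; rewrite !inE => /orP[] /eqP p_eq.
    have [|d [path_d uniq_d d_sub d_x]] := comb path_X uniq_X e_xp (z := b).
      by apply: X_p => //; rewrite p_eq eq_sym.
    exists d; rewrite -p_eq; split=> // v /d_x; rewrite !inE => ->.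
    by rewrite orbT.
  have [|d [path_d uniq_d d_sub d_x]] := comb path_X uniq_X e_xp (z := a).
    by apply: X_p => //; rewrite p_eq.
  exists (rev d); rewrite -p_eq; split.
  - exact: path_rcons_rev.
  - by rewrite -rcons_cons -rev_rcons -rev_cons rev_uniq.
  - by move=> v; rewrite mem_rev => /d_sub.
  - by move=> v /d_x; rewrite !inE mem_rev => /orP[] ->; rewrite ?orbT.
have D_X v : v \in D -> v \in x :: rcons s1 p.
  by move/D_sub; rewrite -rcons_cons mem_rcons inE => ->; rewrite orbT.
have dY_Y v : v \in dY -> v \in pu :: q2.
  move/dY_sub; rewrite def_q2 !inE mem_rev mem_rcons inE => ->.
  by rewrite orbT.
have /and4P[D_b D_a _ uniqD] : [&& b \notin D, a \notin D, b != a & uniq D].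
  by move: uniq_D; rewrite /= mem_rcons rcons_uniq inE negb_or => /andP[/andP[-> ->] /andP[-> ->]].
have /and4P[dY_w dY_pu _ uniqdY] : [&& w \notin dY, pu \notin dY, w != pu & uniq dY].
  by move: uniq_dY; rewrite /= mem_rcons rcons_uniq inE negb_or => /andP[/andP[-> ->] /andP[-> ->]].
have p_ll' : p \in (a :: l) ++ b :: l'.
  move: p_ab; rewrite mem_cat !inE => /orP[] ->; rewrite ?orbT //.
exists ((a :: l) ++ rev dY ++ rev (b :: l') ++ D); split.
- have /perm_uniq -> : perm_eq ((a :: l) ++ rev dY ++ rev (b :: l') ++ D)
      (((a :: l) ++ b :: l') ++ dY ++ D).
    by apply/permP => A; rewrite !count_cat !count_rev [X in _ + X]addnCA addnA.
  rewrite cat_uniq uniq_ll' cat_uniq uniqD uniqdY andbT !andTb; apply/andP; split.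
    apply/hasPn => v; rewrite mem_cat => /orP[v_dY|v_D]; rewrite mem_cat.
      apply/norP; split.
        by apply: contra dY_pu => v_l; rewrite -(Y_l v v_l (dY_Y _ v_dY)).
      by apply: contra dY_w => v_l; rewrite -(Y_l' v v_l (dY_Y _ v_dY)).
    apply/norP; split.
      by apply: contra D_a => v_l; rewrite -(X_l v v_l (D_X _ v_D)).
    by apply: contra D_b => v_l; rewrite -(X_l' v v_l (D_X _ v_D)).
  apply/hasPn => v v_D; apply: contra dY_pu => v_dY.
  by have [_ <-] := XY v (D_X _ v_D) (dY_Y _ v_dY).
- by rewrite cat_cons; apply: glue_cycle => //; rewrite last_l; apply: path_rcons_rev.
have x_y v : v \in x :: s -> e x v -> v \in x :: rcons s1 p.
  rewrite def_s -cat_rcons -cat_cons mem_cat => /orP[//|v_s2] e_xv.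
  by case/hasP: s2_x; exists v.
have y_x v : v \in x :: s -> e y v -> v \in pu :: q2.
  rewrite def_P def_r cat_rcons catA mem_cat => /orP[|//]; rewrite mem_cat.
  case/orP=> v_s e_yv; first by case/hasP: s1_y; exists v.
  by case/hasP: q1_y; exists v.
have sub_c v : v \in (a :: l) ++ b :: l' \/ v \in dY \/ v \in D ->
    v \in (a :: l) ++ rev dY ++ rev (b :: l') ++ D.
  by case=> [|[] v_c]; rewrite !mem_cat !mem_rev ?v_c ?orbT // => /orP[] ->; rewrite ?orbT.
(* Only [p] can be a neighbour of both ends. It is listed once, and [x], which is a neighbour of
   neither end, makes up for its second count. *)
have uniq_N : uniq ((x :: filter (e x) s) ++ [seq v <- x :: s | e y v & v != p]).
  rewrite cat_uniq [uniq (_ :: _)]/= mem_filter e_irr !filter_uniq //.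
    rewrite andTb andbT; apply/hasPn => v; rewrite mem_filter => /andP[/andP[e_yv v_p] v_s].
    apply: contra v_p; rewrite inE mem_filter => v_X; apply/eqP.
    apply: (XY v _ (y_x v v_s e_yv)).1; case/predU1P: v_X => [->|/andP[e_xv v_s']].
      by rewrite mem_head.
    exact: x_y.
  by case/andP: uniq_s.
rewrite [count (e x) _]/= e_irr add0n; apply: leq_trans (uniq_leq_size uniq_N _).
  rewrite size_cat [size (_ :: _)]/= !size_filter addSnnS leq_add2l.
  have -> : count (e y) (x :: s) =
      count (fun v => e y v && (v != p)) (x :: s) + count (fun v => e y v && (v == p)) (x :: s).
    rewrite -count_predUI -[LHS]addn0; congr (_ + _).
      by apply: eq_count => v /=; case: (e y v); case: eqP.
    by rewrite -[LHS](count_pred0 (x :: s)); apply: eq_count => v /=; case: (e y v); case: eqP.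
  rewrite -addn1 leq_add2l.
  apply: leq_trans (_ : count_mem p (x :: s) <= 1); last by rewrite count_uniq_mem // leq_b1.
  by apply: sub_count => v /andP[].
move=> v; rewrite mem_cat => /orP[v_N|].
  apply: sub_c; have : v \in x :: filter (e x) s1 \/ v = p.
    move: v_N; rewrite inE => /predU1P[->|]; first by left; rewrite mem_head.
    rewrite mem_filter => /andP[e_xv v_s].
    have := x_y v _ e_xv; rewrite inE v_s orbT => /(_ isT).
    rewrite -rcons_cons mem_rcons inE => /predU1P[->|v_s1]; first by right.
    left; move: v_s1; rewrite !inE mem_filter e_xv.
    by case/orP=> ->; rewrite ?orbT.
  case=> [/D_x|->]; last by left.
  rewrite in_cons => /predU1P[->|]; first by left; rewrite mem_cat mem_head.
  rewrite in_cons => /predU1P[->|v_D]; last by do 2!right.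
  by left; rewrite mem_cat mem_head orbT.
rewrite mem_filter => /andP[/andP[e_yv _] v_s]; apply: sub_c.
have : v \in w :: dY \/ v = pu.
  have := y_x v v_s e_yv; rewrite inE => /predU1P[->|v_q2]; first by right.
  left; apply: dY_y; move: v_q2.
  by rewrite def_q2 mem_rcons !inE mem_filter e_yv mem_rev.
case=> [|->]; last by left; rewrite mem_cat -last_l mem_last.
rewrite inE => /predU1P[->|->]; last by right; left.
by left; rewrite mem_cat mem_last orbT.
Qed.

(** Either some neighbour of the last vertex precedes a neighbour of the first, and a closest such
    pair gives a crossing cycle, or none does and the vine applies. *)
Lemma posa_cycle x s :
  path e x s -> uniq (x :: s) ->
  exists c, [/\ uniq c, cycle e c &
    minn (size s).+1 (count (e x) (x :: s) + count (e (last x s)) (x :: s))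
      <= size c].
Proof.
move=> path_s uniq_s; have [->|s_neq0] := eqVneq s [::].
  by exists [::]; split=> //=; rewrite e_irr minn0.
have [[L [u [R [def_s e_yu R_x]]]]|no_crossing] :=
  pselect (exists L u R, [/\ x :: s = L ++ u :: R, e (last x s) u & has (e x) R]).
  have [M [v [R' [def_R e_xv _]]]] := split_first_has R_x.
  rewrite {}def_R in def_s.
  have [L' [u' [M' [v' [R'' [def_s' e_yu' e_xv' [M_y M_x] M_sorted]]]]]] :=
    closest_crossing def_s e_yu e_xv.
  exact: crossing_cycle def_s' e_yu' e_xv' M_y M_x M_sorted.
have [|c [uniq_c cycle_c size_c]] := vine_cycle path_s erefl uniq_s s_neq0.
  move=> L u R def_s e_yu; apply/negP => R_x; apply: no_crossing.
  by exists L, u, R.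
by exists c; split=> //; apply: leq_trans size_c; apply: geq_minr.
Qed.

End Relations.

(** * Saturated graphs and degeneracy *)

Section Saturation.

Variables (V : finType) (e : rel V).
Hypothesis e_sym : symmetric e.

(** Some step of the cycle is not in [e], hence is the new edge between [x] and [y]. With more than
    two vertices the cycle uses it only once, and the rest is the path. *)
Lemma new_edge_path (e2 : rel V) k x y c :
  (forall a b, e2 a b -> [\/ e a b, a = x /\ b = y | a = y /\ b = x]) ->
  no_long_cycle e k -> 2 < k -> uniq c -> cycle e2 c -> k <= size c ->
  exists s, [/\ path e x s, uniq (x :: s), last x s = y & k <= size (x :: s)].
Proof.
move=> e2_e e_k k_gt2 uniq_c cycle_c size_c.
have [u u_c e_u] : exists2 u, u \in c & ~~ e u (next c u).
  apply: contraPP (e_k c uniq_c) => no_u; rewrite ltnNge size_c => cycle_e.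
  suff /cycle_e : cycle e c by [].
  apply: cycle_from_next => // u u_c; apply/negPn/negP => e_u; apply: no_u.
  by exists u.
case/rot_to: u_c => i c' def_c.
have def_next : next c u = next (u :: c') u by rewrite -def_c next_rot.
have {uniq_c} uniq_c : uniq (u :: c') by rewrite -def_c rot_uniq.
have {cycle_c} cycle_c : cycle e2 (u :: c') by rewrite -def_c rot_cycle.
have {size_c} size_c : k <= size (u :: c') by rewrite -def_c size_rot.
case: c' => [|v [|w c']] in def_c def_next uniq_c cycle_c size_c; try by move: size_c => /=; lia.
rewrite {}def_next /= eqxx in e_u.
case/and3P: cycle_c => e_uv e_vw path_w.
case/and3P: uniq_c; rewrite !inE !negb_or.
move=> /and3P[u_v u_w u_c'] /andP[v_w v_c'] uniq_c.
have uv_xy : (u = x /\ v = y) \/ (u = y /\ v = x).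
  by case: (e2_e _ _ e_uv) => [e_uv'| |]; [rewrite e_uv' in e_u | left | right].
have e2_e' a b : e2 a b -> (a != v) && (b != v) || (a != u) && (b != u) -> e a b.
  move=> /e2_e[]// [-> ->]; case: uv_xy => -[-> ->]; rewrite !eqxx ?andbF //=.
have path_v : path e v (w :: rcons c' u).
  have e_vw' : e v w by apply: e2_e' e_vw _; rewrite [v == u]eq_sym u_v [w == u]eq_sym u_w orbT.
  rewrite /= e_vw' /=.
  apply: (@sub_in_path _ (predC1 v) e2) path_w.
    by move=> a b; rewrite !inE => a_v b_v /e2_e'; apply; rewrite a_v b_v.
  rewrite /= eq_sym v_w all_rcons /= u_v; apply/allP => z z_c' /=.
  by apply: contraNneq v_c' => <-.
have uniq_v : uniq (v :: w :: rcons c' u).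
  have /andP[w_c' uniq_c'] : (w \notin c') && uniq c' by [].
  rewrite /= !inE !mem_rcons !inE !negb_or rcons_uniq v_w v_c' w_c' u_c' uniq_c'.
  by rewrite [v == u]eq_sym u_v [w == u]eq_sym u_w.
have last_v : last v (w :: rcons c' u) = u by rewrite /= last_rcons.
have size_v : k <= size (v :: w :: rcons c' u) by rewrite /= size_rcons.
case: uv_xy => -[u_eq v_eq]; last by exists (w :: rcons c' u); rewrite -v_eq -u_eq.
rewrite -u_eq -v_eq.
have rev_v : u :: rev (belast v (w :: rcons c' u)) = rev (v :: w :: rcons c' u).
  by rewrite [v :: w :: _]lastI rev_rcons last_v.
exists (rev (belast v (w :: rcons c' u))); split.
- by rewrite -[u in path _ u]last_v path_rev.
- by rewrite rev_v rev_uniq.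
- by rewrite -[LHS]/(last v (u :: _)) rev_v rev_cons last_rcons.
- by rewrite rev_v size_rev.
Qed.

Hypothesis e_irr : irreflexive e.
Hypothesis e_2c : two_conn e.

Definition nonadj_path (K : {set V}) x s :=
  [/\ x \in K /\ last x s \in K, path e x s, uniq (x :: s),
      x != last x s & ~~ e x (last x s)].

Variables (t : nat) (K : {set V}).
Hypothesis e_cyc : no_long_cycle e (t.*2 + 2).
Hypothesis K_deg : forall v, v \in K -> t < #|[set u in K | e v u]|.

Lemma rev_belast x (s : seq V) : last x s :: rev (belast x s) = rev (x :: s).
Proof. by rewrite [in RHS]lastI rev_rcons. Qed.

Lemma last_rev_belast x (s : seq V) : last (last x s) (rev (belast x s)) = x.
Proof. by rewrite -[LHS]/(last x (last x s :: _)) rev_belast rev_cons last_rcons. Qed.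

Lemma nonadj_path_rev x s : nonadj_path K x s -> nonadj_path K (last x s) (rev (belast x s)).
Proof.
move=> [[x_K y_K] path_s uniq_s x_y e_xy]; split; rewrite ?last_rev_belast //.
- exact: path_rev.
- by rewrite rev_belast rev_uniq.
- by rewrite eq_sym.
- by rewrite e_sym.
Qed.

(** The new end [z] is not adjacent to the far end, since the prolonged path would otherwise close
    to a long cycle. *)
Lemma nonadj_path_extend x s z :
  nonadj_path K x s -> t.*2 + 2 <= (size s).+1 -> z \in K -> e x z -> z \notin x :: s ->
  nonadj_path K z (x :: s).
Proof.
move=> [[x_K y_K] path_s uniq_s x_y e_xy] size_s z_K e_xz z_s; split=> //=.
- by rewrite e_sym e_xz.
- by rewrite z_s.
- by apply: contraNneq z_s => ->; apply: mem_last.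
apply/negP => e_zy; have := @e_cyc (z :: x :: s); rewrite ltnNge => /(_ _ _)/negP[].
- by rewrite cons_uniq z_s.
- by rewrite /= rcons_path e_sym e_xz path_s e_sym.
- by rewrite /=; apply: leqW.
Qed.

(** An end with a neighbour in [K] off the path allows an extension. If neither end has one, each
    has at least t + 1 neighbours on the path, against Posa's lemma. *)
Lemma nonadj_path_longer x s : nonadj_path K x s -> t.*2 + 2 <= (size s).+1 ->
  exists x' s', nonadj_path K x' s' /\ size s' = (size s).+1.
Proof.
move=> bad_s size_s.
have [[z [z_K e_xz z_s]]|no_x] := pselect (exists z, [/\ z \in K, e x z & z \notin x :: s]).
  by exists z, (x :: s); split=> //; apply: nonadj_path_extend.
have [[z [z_K e_yz z_s]]|no_y] :=
    pselect (exists z, [/\ z \in K, e (last x s) z & z \notin x :: s]).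
  exists z, (last x s :: rev (belast x s)); split; last by rewrite rev_belast size_rev.
  apply: nonadj_path_extend => //; first exact: nonadj_path_rev.
    by rewrite size_rev size_belast.
  by rewrite rev_belast mem_rev.
have le_count v : v \in K -> (forall z, z \in K -> e v z -> z \in x :: s) ->
    t < count (e v) (x :: s).
  move=> v_K v_s; apply: leq_trans (K_deg v_K) _; rewrite cardE -size_filter.
  apply: uniq_leq_size (enum_uniq _) _ => z; rewrite mem_enum inE => /andP[z_K e_vz].
  by rewrite mem_filter e_vz v_s.
case: bad_s => [[x_K y_K] path_s uniq_s _ _].
have [c [uniq_c cycle_c]] := posa_cycle e_sym e_irr e_2c path_s uniq_s.
rewrite leqNgt => /negP[]; apply: leq_trans (e_cyc uniq_c cycle_c) _.
rewrite leq_min size_s -addnn addnS addn1 -addSn -addnS; apply: leq_add; apply: le_count => // z z_K e_z.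
  by apply/negPn/negP => z_s; apply: no_x; exists z.
by apply/negPn/negP => z_s; apply: no_y; exists z.
Qed.

Hypothesis e_sat : forall x y, x != y -> ~~ e x y ->
  exists s, [/\ path e x s, uniq (x :: s), last x s = y
    & t.*2 + 2 <= size (x :: s)].

(* A longest path between nonadjacent vertices of K contains all neighbours
   in K of both its ends, so that Posa's lemma gives a cycle of length
   2t + 2. *)
Lemma core_clique : {in K &, forall x y, x != y -> e x y}.
Proof.
move=> x y x_K y_K x_y; apply/negPn/negP => e_xy.
(* Saturation supplies the first path, already on 2t + 2 vertices; repeated lengthening then exceeds
   [#|V|]. *)
suff longer n : exists x s, nonadj_path K x s /\ maxn n (t.*2 + 1) <= size s.
  have [z [s [[_ _ uniq_s _ _] size_s]]] := longer #|V|.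
  have := card_size (z :: s); rewrite (card_uniqP uniq_s) => _.
  have := max_card [in z :: s]; rewrite (card_uniqP uniq_s) /= ltnNge.
  by rewrite (leq_trans (leq_maxl _ _) size_s).
elim: n => [|n [x' [s [bad_s size_s]]]].
  have [s [path_s uniq_s last_s size_s]] := e_sat x_y e_xy.
  exists x, s; split; first by split; rewrite ?last_s.
  by rewrite max0n -ltnS -addnS.
have [|x'' [s' [bad_s' size_s']]] := nonadj_path_longer bad_s.
  by rewrite addnS ltnS; apply: leq_trans size_s; apply: leq_maxr.
exists x'', s'; split=> //; rewrite size_s'.
by move: size_s; rewrite !geq_max ltnS => /andP[-> /leqW].
Qed.

(** A clique on at least three vertices, listed in any order, is a cycle. *)
Lemma card_core : 0 < t -> #|K| < t.*2 + 2.
Proof.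
move=> t_gt0; rewrite ltnNge; apply/negP => K_big.
have: cycle e (enum K).
  have size_K : 2 < size (enum K) by rewrite -cardE; lia.
  case def_K: (enum K) size_K (enum_uniq K) => [|x s] //= size_s /andP[x_s uniq_s].
  have K_s z : z \in x :: s -> z \in K by rewrite -def_K mem_enum.
  have e_K := sub_in2 K_s core_clique.
  rewrite rcons_path; apply/andP; split; last first.
    apply: e_K; rewrite ?mem_last ?mem_head //.
    case: (s) x_s size_s => // z s' x_s _.
    by apply: contraNneq x_s => <-; apply: (mem_last z s').
  apply: (@pairwise_sorted _ e (x :: s)).
  have: pairwise [rel a b | a != b] (x :: s) by rewrite -uniq_pairwise /= x_s.
  apply: (@sub_in_pairwise _ [in x :: s] [rel a b | a != b] e); last exact/allP.
  exact: e_K.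
move/(e_cyc (enum_uniq _)); rewrite -cardE ltnNge K_big.
by [].
Qed.

End Saturation.

(** Peel off vertices of degree at most [t] in the remaining set [S] until [K] is left. A peeled
    vertex gets rank [#|S|], so its neighbours of smaller rank are among those still present. *)
Lemma degenerate_rank (V : finType) (e : rel V) t (K : {set V}) :
  (forall S : {set V}, K \proper S ->
     exists v, [/\ v \in S, v \notin K & #|[set u in S | e v u]| <= t]) ->
  exists rk : V -> nat,
  [/\ {in K, forall u, rk u = 0}, {in [predC K], forall v, 0 < rk v},
      {in [predC K] &, injective rk}
    & {in [predC K], forall v, #|[set u | e v u & rk u < rk v]| <= t}].
Proof.
move=> degen.
suff rank n (S : {set V}) : K \subset S -> #|S| <= n -> exists rk : V -> nat,
    [/\ {in K, forall u, rk u = 0}, {in S :\: K, forall v, 0 < rk v <= #|S|},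
        {in S :\: K &, injective rk}
      & {in S :\: K, forall v, #|[set u in S | e v u & rk u < rk v]| <= t}].
  have [rk [rk0 rk_gt0 rk_inj rk_t]] := rank #|V| setT (subsetT K) (max_card _).
  have memC v : v \in [predC K] -> v \in [set: V] :\: K by rewrite !inE andbT.
  exists rk; split=> //.
  - by move=> v /memC/rk_gt0/andP[].
  - by move=> u v /memC u_K /memC v_K; apply: rk_inj.
  - move=> v /memC/rk_t; apply: leq_trans; apply/subset_leq_card/subsetP => u.
    by rewrite !inE.
elim: n S => [|n IH] S K_S size_S.
  have S0 : S = set0 by apply/eqP; rewrite -cards_eq0 -leqn0.
  exists (fun=> 0); split=> //; by move=> v; rewrite !inE S0 inE andbF.
have [S_K|S_K] := eqVneq S K.
  exists (fun=> 0); split=> //; by move=> v; rewrite S_K setDv inE.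
have [|v [v_S v_K deg_v]] := degen S; first by rewrite properEneq eq_sym S_K.
have K_S' : K \subset S :\ v by rewrite subsetD1 K_S.
have card_S : #|S| = #|S :\ v|.+1 by rewrite (cardsD1 v) v_S.
have [|rk [rk0 rk_gt0 rk_inj rk_t]] := IH _ K_S'; first by rewrite -ltnS -card_S.
have memS u : u \in S :\: K -> u != v -> u \in (S :\ v) :\: K.
  by rewrite !inE => /andP[-> ->] ->.
have rk_lt u : u \in S -> u != v -> rk u < #|S|.
  move=> u_S u_v; have [u_K|u_K] := boolP (u \in K).
    by rewrite rk0 // card_S.
  rewrite card_S ltnS; have := rk_gt0 u; rewrite !inE u_K u_v u_S => /(_ isT).
  by case/andP.
exists (fun u => if u == v then #|S| else rk u); split.
- by move=> u u_K; rewrite ifN ?rk0 //; apply: contraNneq v_K => <-.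
- move=> u u_S; case: eqVneq => [_|u_v]; first by rewrite card_S leqnn.
  have /andP[-> /= le_S] := rk_gt0 u (memS _ u_S u_v).
  by apply: leq_trans le_S _; rewrite card_S.
- move=> u w u_S w_S; have [u_v|u_v] := eqVneq u v; have [w_v|w_v] := eqVneq w v => //.
  + by rewrite u_v w_v.
  + by move=> eq_w; have := rk_lt w; rewrite -eq_w ltnn w_v; case/setDP: w_S => -> _ /(_ isT isT).
  + by move=> eq_u; have := rk_lt u; rewrite eq_u ltnn u_v; case/setDP: u_S => -> _ /(_ isT isT).
  + by apply: rk_inj; apply: memS.
- move=> u u_S; have [u_v|u_v] := eqVneq u v.
    apply: leq_trans deg_v; apply/subset_leq_card/subsetP => w.
    by rewrite !inE u_v => /and3P[-> ->].
  apply: leq_trans (rk_t u (memS _ u_S u_v)); apply/subset_leq_card/subsetP => w.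
  rewrite !inE; case: eqVneq => [_|w_v] //= /and3P[_ _].
  by rewrite ltnNge ltnW // rk_lt //; case/setDP: u_S.
Qed.

Section GraphBasics.

Variables (V : finType).
Implicit Types G : graph V.

Lemma adj_sym G : symmetric (adj G).
Proof. by move=> x y; rewrite /adj /= setUC. Qed.

Lemma adj_irr G : irreflexive (adj G).
Proof.
move=> x; apply: contraTF isT => /(subsetP (edges_card2 G)).
by rewrite inE setUid cards1.
Qed.

Lemma edgeP G f : f \in edges G -> exists x y, [/\ x != y, f = [set x; y] & adj G x y].
Proof.
move=> f_G; have := subsetP (edges_card2 G) f f_G; rewrite inE => /cards2P[x [y [x_y def_f]]].
by exists x, y; split=> //; rewrite /adj /= -def_f.
Qed.

Lemma eq_set2 (a b x y : V) :
  [set a; b] = [set x; y] -> (a = x /\ b = y) \/ (a = y /\ b = x).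
Proof.
move=> /setP eq_ab; move: (eq_ab a) (eq_ab b) (eq_ab x) (eq_ab y); rewrite !inE !eqxx !orbT /=.
move=> /esym/orP[] /eqP -> /esym/orP[] /eqP ->; rewrite !eqxx ?orbT ?orbF ?orbb; auto.
  by move=> _ /eqP->; auto.
by move=> /eqP->; auto.
Qed.

Lemma add_edge_card2 G (x y : V) (x_y : x != y) :
  [set x; y] |: edges G \subset [set e : {set _} | #|e| == 2].
Proof. by rewrite subUset sub1set inE cards2 x_y edges_card2. Qed.

Definition add_edge G x y (x_y : x != y) : graph V := Graph (add_edge_card2 G x_y).

Lemma two_conn_sub (e e' : rel V) : subrel e e' -> two_conn e -> two_conn e'.
Proof.
move=> sub [V3 e_2c]; split=> // v x y x_v y_v; apply: connect_sub (e_2c v x y x_v y_v).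
by move=> a b /and3P[e_ab a_v b_v]; apply/connect1/and3P; split=> //; apply: sub.
Qed.

(** Take a supergraph with the most edges among those without long cycles: any further edge creates
    a long cycle through it, which contains the path. *)
Lemma saturated_supergraph G k : 2 < k -> no_long_cycle (adj G) k ->
  exists G', [/\ subrel (adj G) (adj G'), no_long_cycle (adj G') k &
    forall x y, x != y -> ~~ adj G' x y ->
    exists s, [/\ path (adj G') x s, uniq (x :: s), last x s = y
      & k <= size (x :: s)]].
Proof.
move=> k_gt2 G_k.
pose Q G' := (edges G \subset edges G') && `[< no_long_cycle (adj G') k >].
have QG : Q G by rewrite /Q subxx; apply/asboolP.
case: (@arg_maxnP _ G Q (fun G' => #|edges G'|) QG) => G' /andP[G_G' /asboolP G'_k] G'_max.
exists G'; split=> // [x y /(subsetP G_G')//|x y x_y G'_xy].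
pose G2 := add_edge G' x_y.
have G2_G' a b : adj G2 a b -> [\/ adj G' a b, a = x /\ b = y | a = y /\ b = x].
  by rewrite /adj /= in_setU1 => /predU1P[/eq_set2[]|]; [constructor 2|constructor 3|constructor 1].
have [G2_k|[c [uniq_c cycle_c size_c]]] : no_long_cycle (adj G2) k \/
    exists c, [/\ uniq c, cycle (adj G2) c & k <= size c].
- have [[c c_long]|no_c] := pselect (exists c, [/\ uniq c, cycle (adj G2) c & k <= size c]).
    by right; exists c.
  left=> c uniq_c cycle_c; rewrite ltnNge; apply/negP => size_c.
  by apply: no_c; exists c.
- have: Q G2 by rewrite /Q; apply/andP; split; [rewrite subsetU // G_G' orbT|apply/asboolP].
  move/G'_max; rewrite /= leqNgt cardsU1.
  by rewrite -[[set x; y] \notin _]/(~~ adj G' x y) G'_xy add1n ltnSn.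
by have [s [? ? ? ?]] := new_edge_path (@adj_sym G') G2_G' G'_k k_gt2 uniq_c cycle_c size_c; exists s.
Qed.

(** [K] is a largest set of inner degrees above [t] in a saturated supergraph, hence a clique and
    small. A larger set has a vertex of inner degree at most [t]; if it contains [K], this vertex
    lies outside [K], whose members keep their neighbours in [K]. So the peeling never touches
    [K]. *)
Lemma kopylov_rank G t : 0 < t -> two_conn (adj G) ->
  no_long_cycle (adj G) (t.*2 + 2) ->
  exists (K : {set V}) (rk : V -> nat),
  [/\ #|K| < t.*2 + 2, {in K, forall u, rk u = 0}, {in [predC K], forall v, 0 < rk v},
      {in [predC K] &, injective rk}
    & {in [predC K], forall v, #|[set u | adj G v u & rk u < rk v]| <= t}].
Proof.
move=> t_gt0 G_2c G_k; have k_gt2 : 2 < t.*2 + 2 by lia.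
have [G' [G_G' G'_k G'_sat]] := saturated_supergraph k_gt2 G_k.
pose Q (S : {set V}) := [forall v in S, t < #|[set u in S | adj G' v u]|].
have Q0 : Q set0 by apply/forall_inP => v; rewrite inE.
case: (@arg_maxnP _ set0 Q (fun S => #|S|) Q0) => K /forall_inP QK K_max.
have card_K := card_core (@adj_sym G') (@adj_irr G') (two_conn_sub G_G' G_2c)
  G'_k QK G'_sat t_gt0.
have [|rk [rk0 rk_gt0 rk_inj rk_t]] := @degenerate_rank V (adj G') t K.
  move=> S K_S; have: ~~ Q S.
    by apply: contraTN (proper_card K_S) => /K_max; rewrite /= leqNgt.
  case/forall_inPn => v v_S; rewrite -leqNgt => deg_v; exists v; split=> //.
  apply: contraTN deg_v => /QK; rewrite -ltnNge => /leq_trans; apply.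
  apply/subset_leq_card/subsetP => u; rewrite !inE => /andP[u_K ->].
  by rewrite (subsetP (proper_sub K_S)).
exists K, rk; split=> // v /rk_t; apply: leq_trans; apply/subset_leq_card/subsetP => u.
by rewrite !inE => /andP[/G_G' -> ->].
Qed.

End GraphBasics.

(** * A large biclique *)

Lemma card_bigcup_le (I T : finType) (A : {pred I}) (F : I -> {set T}) :
  #|\bigcup_(i in A) F i| <= \sum_(i in A) #|F i|.
Proof.
elim/big_rec2: _ => [|i m S _ le_S]; first by rewrite cards0.
by rewrite (leq_trans (leq_card_setU _ _)) // leq_add2l.
Qed.

(** A level of size s has 2 ^ s subsets, each of which is the back set of at most [M] new
    vertices. *)
Fixpoint level_size (b M j : nat) : nat :=
  if j is j'.+1 then level_size b M j' + 2 ^ level_size b M j' * M else b.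

(* Level j + 1 adds the vertices all of whose back neighbours lie in level j,
   so a vertex outside level j starts a descending path with j steps. *)
Lemma level_bound (V : finType) (back : V -> {set V}) (B : {set V}) M :
  (forall A : {set V}, #|[set v in ~: B | back v == A]| <= M) ->
  forall j, exists S : {set V},
  [/\ B \subset S, #|S| <= level_size #|B| M j &
      forall v, v \notin S -> exists l, size l = j /\
        path (fun w u => u \in back w) v l].
Proof.
move=> back_M; elim=> [|j [S [B_S card_S chain_S]]].
  by exists B; split=> // v _; exists [::].
pose S' := [set v in ~: B | back v \subset S].
exists (S :|: S'); split.
- by rewrite subsetU // B_S.
- have le_S' : #|S'| <= 2 ^ #|S| * M.
    have S'_sub : S' \subset \bigcup_(A in powerset S) [set v in ~: B | back v == A].
      apply/subsetP => v; rewrite inE => /andP[v_B v_S]; apply/bigcupP.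
      by exists (back v); rewrite ?powersetE // inE v_B eqxx.
    apply: leq_trans (subset_leq_card S'_sub) _; apply: leq_trans (card_bigcup_le _ _) _.
    by rewrite -card_powerset -sum_nat_const; apply: leq_sum.
  apply: leq_trans (leq_card_setU _ _) _; apply: leq_add => //.
  by apply: leq_trans le_S' _; rewrite leq_mul2r leq_pexp2l ?orbT.
- move=> v; rewrite inE negb_or inE negb_and in_setC negbK => /andP[v_S].
  have -> /= : v \in B = false by apply: contraNF v_S; apply: (subsetP B_S).
  case/subsetPn => u u_v /chain_S[l [size_l path_l]].
  by exists (u :: l); rewrite /= size_l u_v.
Qed.

Section Dense.

Variables (V : finType) (G : graph V) (t : nat) (K : {set V}) (rk : V -> nat).
Hypothesis rk0 : {in K, forall u, rk u = 0}.
Hypothesis rk_gt0 : {in [predC K], forall v, 0 < rk v}.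
Hypothesis rk_inj : {in [predC K] &, injective rk}.

Let back v := [set u | adj G v u & rk u < rk v].

Hypothesis rk_t : {in [predC K], forall v, #|back v| <= t}.

(** Edges inside [K] are subsets of [K]; any other edge is counted at its end of larger rank. *)
Lemma card_edges_rank : #|edges G| <= 2 ^ #|K| + \sum_(v in ~: K) #|back v|.
Proof.
have edges_sub : edges G \subset
    powerset K :|: \bigcup_(v in ~: K) [set [set u; v] | u in back v].
  apply/subsetP => f /edgeP[x [y [x_y -> G_xy]]].
  wlog rk_xy : x y x_y G_xy / rk x <= rk y.
    move=> hyp; have [|/ltnW] := leqP (rk x) (rk y); first exact: hyp.
    by rewrite [[set x; y]]setUC; apply: hyp; rewrite 1?adj_sym 1?eq_sym.
  have [y_K|y_K] := boolP (y \in K).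
    have x_K : x \in K.
      apply: contraTT rk_xy => x_K; rewrite (rk0 y_K) -ltnNge.
      exact: rk_gt0.
    by rewrite inE powersetE subUset !sub1set x_K y_K.
  have rk_lt : rk x < rk y.
    rewrite ltn_neqAle rk_xy andbT; have [x_K|x_K] := boolP (x \in K).
      by rewrite (rk0 x_K) eq_sym -lt0n; apply: rk_gt0.
    by apply: contra x_y => /eqP/rk_inj->.
  rewrite inE; apply/orP; right; apply/bigcupP; exists y; rewrite ?inE //.
  by apply/imsetP; exists x; rewrite // inE adj_sym G_xy.
apply: leq_trans (subset_leq_card edges_sub) _.
apply: leq_trans (leq_card_setU _ _) _; rewrite card_powerset leq_add2l.
apply: leq_trans (card_bigcup_le _ _) _; apply: leq_sum => v _.
exact: leq_imset_card.
Qed.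

(** Every low vertex falls short of its [t] possible edges by at least one, and the number of edges
    leaves room for only a bounded total shortfall. *)
Lemma card_low_back : t * (#|V| - t) <= #|edges G| ->
  #|[set v in ~: K | #|back v| < t]| <= 2 ^ #|K| + t * t.
Proof.
move=> G_big; set low := [set _ in _ | _].
have le_sum : \sum_(v in ~: K) #|back v| + #|low| <= t * #|V|.
  have -> : #|low| = \sum_(v in ~: K) (#|back v| < t).
    rewrite -sum1_card big_mkcond [RHS]big_mkcond; apply: eq_bigr => v _.
    by rewrite !inE; case: (v \in K) => //=; case: ltnP.
  rewrite -big_split /=; apply: (@leq_trans (\sum_(v in ~: K) t)).
    apply: leq_sum => v; rewrite inE => v_K; have := rk_t v_K.
    by case: ltnP => [lt_v _|_ le_v]; rewrite ?addn1 ?addn0.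
  by rewrite sum_nat_const mulnC leq_mul2l max_card orbT.
have := card_edges_rank; have : t * #|V| <= t * (#|V| - t) + t * t by rewrite -mulnDr; nia.
lia.
Qed.

End Dense.

(** Levels start from [K] and the vertices with fewer than [t] earlier neighbours. Without the
    biclique their sizes are bounded in terms of [t] and [M], so a large graph has a vertex outside
    level [L]; it starts a descending path with [L] edges, one more than [path_size_bound]
    allows. *)
Lemma dense_biclique (t M : nat) : 0 < t -> exists n0, forall (V : finType) (G : graph V),
  n0 <= #|V| -> two_conn (adj G) -> no_long_cycle (adj G) (t.*2 + 2) ->
  t * (#|V| - t) <= #|edges G| ->
  exists A : {set V}, #|A| = t /\
    M <= #|[set v | A \subset [set u | adj G v u]]|.
Proof.
move=> t_gt0; set k := t.*2 + 2.
pose b := k + (2 ^ k + t * t).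
pose L := (k * k).+1.
exists (level_size b M L).+1 => V G V_big G_2c G_k G_big.
have [K [rk [card_K rk0 rk_gt0 rk_inj rk_t]]] := kopylov_rank t_gt0 G_2c G_k.
pose back v := [set u | adj G v u & rk u < rk v].
pose B := K :|: [set v in ~: K | #|back v| < t].
have card_B : #|B| <= b.
  apply: leq_trans (leq_card_setU _ _) _; apply: leq_add; first exact: ltnW.
  apply: leq_trans (card_low_back rk0 rk_gt0 rk_inj rk_t G_big) _.
  by rewrite leq_add2r leq_pexp2l // ltnW.
have [[A [card_A A_M]]|noA] := pselect (exists A : {set V}, #|A| = t /\
    M <= #|[set v | A \subset [set u | adj G v u]]|); first by exists A.
(* A back set of a vertex outside [B] has exactly [t] elements, so one shared by more than [M]
   vertices would be the biclique. *)
have back_M (A : {set V}) : #|[set v in ~: B | back v == A]| <= M.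
  set S := [set v in _ | _]; have [->|[v v_S]] := set_0Vmem S; first by rewrite cards0.
  have := v_S; rewrite !inE negb_or negb_and negbK => /andP[/andP[v_K v_B] /eqP def_A].
  rewrite leqNgt; apply/negP => /ltnW S_M; apply: noA; exists A; split.
    rewrite (negbTE v_K) /= -leqNgt in v_B; apply/eqP.
    by rewrite eqn_leq -def_A v_B rk_t.
  apply: leq_trans S_M _; apply/subset_leq_card/subsetP => u.
  rewrite !inE => /andP[_ /eqP <-]; apply/subsetP => w.
  by rewrite !inE => /andP[].
have [S [_ card_S chain_S]] := level_bound back_M L.
have level_mono b1 b2 j : b1 <= b2 -> level_size b1 M j <= level_size b2 M j.
  move=> le_b; elim: j => //= j le_j; apply: leq_add => //.
  by rewrite leq_mul2r leq_pexp2l ?orbT.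
have [v v_S] : exists v, v \notin S.
  apply/existsP; rewrite -[[exists v, _]]negbK negb_exists; apply/negP => /forallP S_all.
  have := leq_trans card_S (level_mono _ _ L card_B); rewrite leqNgt => /negP[].
  apply: leq_trans V_big _; apply: subset_leq_card; apply/subsetP => v _.
  by have := S_all v; rewrite negbK.
have [l [size_l path_l]] := chain_S v v_S.
have path_G : path (adj G) v l by apply: sub_path path_l => u w; rewrite inE => /andP[].
have uniq_l : uniq (v :: l).
  have: sorted (fun w u => rk u < rk w) (v :: l).
    by apply: sub_path path_l => u w; rewrite inE => /andP[].
  apply: (@sorted_uniq _ (fun w u => rk u < rk w)).
    by move=> x y z yx zy; apply: ltn_trans yx.
  by move=> x; apply: ltnn.
have k_gt2 : 2 < k by rewrite /k; lia.
have := path_size_bound (@adj_sym V G) G_2c k_gt2 G_k path_G uniq_l.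
by rewrite size_l ltnn.
Qed.

(** * Structure around a biclique *)

Section Hub.

Variables (V : finType) (G : graph V) (t : nat) (A : {set V}).

Let k := t.*2 + 2.
Let full : {set V} := [set v | A \subset [set u | adj G v u]].

Hypothesis t_gt1 : 1 < t.
Hypothesis card_A : #|A| = t.
Hypothesis G_2c : two_conn (adj G).
Hypothesis G_k : no_long_cycle (adj G) k.
(* k * k bounds the number of edges of a path; the rest leaves room for the
   fresh common neighbours that close it up to a cycle through all of A. *)
Hypothesis full_big : k * k + k + k <= #|full|.

Lemma adj_full v a : v \in full -> a \in A -> adj G v a.
Proof. by rewrite inE => /subsetP sub /sub; rewrite inE. Qed.

Lemma full_notin v : v \in full -> v \notin A.
Proof. by move=> v_full; apply/negP => /(adj_full v_full); rewrite adj_irr. Qed.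

Lemma fresh_full (U : seq V) : size U < #|full| -> exists2 c, c \in full & c \notin U.
Proof.
move=> size_U; apply/exists_inP; rewrite -[[exists _ in _, _]]negbK negb_exists_in.
apply: contraL size_U => /forall_inP full_U; rewrite -leqNgt.
apply: leq_trans (card_size U); apply: subset_leq_card; apply/subsetP => c /full_U.
by rewrite negbK.
Qed.

(** [W] follows each vertex of [s] by a fresh vertex of [full] outside [U], the last of which leads
    to [a0]. For empty [s], [p] is joined to [a0] directly. *)
Lemma weave a0 (s U : seq V) : a0 \in A -> {subset s <= A} -> uniq s ->
  size s + size U <= #|full| ->
  exists W, [/\ size W = (size s).*2, uniq W,
    forall w, w \in W -> w \in s \/ w \in full /\ w \notin U
    & forall p, adj G p (head a0 s) -> path (adj G) p (rcons W a0)].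
Proof.
move=> a0_A; elim: s U => [|b s IH] U s_A.
  by move=> _ _; exists [::]; split=> //= p ->.
move=> /= /andP[b_s uniq_s] size_U.
have [|c c_full c_U] := @fresh_full U; first by apply: leq_trans size_U; rewrite ltnS leq_addl.
have b_A : b \in A by apply: s_A; rewrite mem_head.
have {}s_A : {subset s <= A} by move=> z z_s; apply: s_A; rewrite inE z_s orbT.
have [|W [size_W uniq_W mem_W path_W]] := IH (c :: U) s_A uniq_s.
  by rewrite /= addnS -addSn.
exists [:: b, c & W]; split.
- by rewrite /= size_W.
- have c_A := full_notin c_full; rewrite /= inE negb_or uniq_W andbT -andbA; apply/and3P; split.
  + by apply: contraNneq c_A => <-.
  + apply/negP => /mem_W[b_s'|[/full_notin]]; last by rewrite b_A.
    by rewrite b_s' in b_s.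
  + apply/negP => /mem_W[/s_A|[_]]; first by rewrite (negbTE c_A).
    by rewrite mem_head.
- move=> w; rewrite in_cons => /predU1P[->|]; first by left; rewrite mem_head.
  rewrite in_cons => /predU1P[->|/mem_W[w_s|[w_full]]]; first by right.
    by left; rewrite in_cons w_s orbT.
  by rewrite in_cons negb_or => /andP[_ w_U]; right.
- move=> p /= e_pb; rewrite e_pb adj_sym adj_full //=.
  apply: path_W; apply: adj_full => //; case: (s) s_A => //= d s' s_A.
  by apply: s_A; rewrite mem_head.
Qed.

(** The cycle runs through [a0], [P0], [a1], [P1] and then weaves through the other t - 2 vertices
    of [A]. It has [size (P0 ++ P1)] + 2 + 2(t - 2) vertices, which must be less than 2t + 2. *)
Lemma hub_cycle a0 a1 P0 P1 :
  a0 \in A -> a1 \in A -> a0 != a1 -> ~~ has [in A] (P0 ++ P1) -> uniq (P0 ++ P1) ->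
  size (P0 ++ P1) <= k * k + k ->
  path (adj G) a0 (rcons P0 a1) ->
  (forall b, b \in A -> b != a1 -> path (adj G) a1 (rcons P1 b)) ->
  size (P0 ++ P1) < 4.
Proof.
move=> a0_A a1_A a01 P_A uniq_P size_P path_P0 path_P1.
pose s := enum (A :\ a0 :\ a1).
have s_A : {subset s <= A} by move=> z; rewrite mem_enum !inE => /and3P[].
have size_s : size s = t - 2.
  rewrite -cardE; have := cardsD1 a0 A; have := cardsD1 a1 (A :\ a0).
  by rewrite !inE a0_A a1_A eq_sym a01 card_A /= => -> ->; rewrite !add1n !subSS subn0.
have [|W [size_W uniq_W mem_W path_W]] := @weave a0 s (P0 ++ P1) a0_A s_A (enum_uniq _).
  apply: leq_trans full_big; rewrite addnC; apply: leq_add => //.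
  by rewrite size_s /k -addnn; lia.
have head_A : head a0 s \in A.
  by case: (s) s_A => //= z s' s_A; apply: s_A; rewrite mem_head.
have head_a1 : head a0 s != a1.
  case def_s: s => [|z s'] //=; have: z \in s by rewrite def_s mem_head.
  by rewrite mem_enum !inE => /andP[].
pose c := a0 :: P0 ++ a1 :: P1 ++ W.
have size_c : size c = size (P0 ++ P1) + 2 + size W.
  by rewrite /c /= !size_cat /= size_cat; lia.
have uniq_c : uniq c.
  have perm_c : perm_eq c ((P0 ++ P1) ++ [:: a0, a1 & W]).
    apply/permP => Q; rewrite /c /= !count_cat /= !count_cat.
    by lia.
  rewrite (perm_uniq perm_c) cat_uniq uniq_P andTb; apply/andP; split.
    apply/hasPn => w w_c; apply/negP => w_P; have w_A := hasPn P_A w w_P.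
    move: w_c; rewrite !inE => /or3P[/eqP w_a|/eqP w_a|/mem_W[/s_A|[_]]].
    - by rewrite w_a /= a0_A in w_A.
    - by rewrite w_a /= a1_A in w_A.
    - by rewrite (negbTE w_A).
    - by rewrite w_P.
  rewrite /= uniq_W inE negb_or a01 andbT /=; apply/andP; split.
    apply/negP => /mem_W[|[/full_notin]]; last by rewrite a0_A.
    by rewrite mem_enum !inE eqxx andbF.
  apply/negP => /mem_W[|[/full_notin]]; last by rewrite a1_A.
  by rewrite mem_enum !inE eqxx.
have cycle_c : cycle (adj G) c.
  rewrite /c /cycle rcons_cat rcons_cons -cat_rcons cat_path path_P0 last_rcons rcons_cat.
  have := path_P1 _ head_A head_a1; rewrite rcons_path => /andP[path_P1' e_P1].
  by rewrite cat_path path_P1' path_W.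
have := G_k uniq_c cycle_c; rewrite size_c size_W size_s /k -!addnn; lia.
Qed.

(** Apply [hub_cycle] with the path as [P0] and a single fresh common neighbour as [P1]. *)
Lemma short_detour x l a b : ~~ has [in A] (x :: l) -> path (adj G) x l -> uniq (x :: l) ->
  a \in A -> b \in A -> a != b -> adj G x a -> adj G (last x l) b -> size l <= 1.
Proof.
move=> l_A path_l uniq_l a_A b_A ab e_xa e_lb.
have size_l : size l <= k * k.
  by apply: path_size_bound path_l uniq_l => //; [apply: adj_sym | rewrite /k; lia].
have [|c c_full c_l] := @fresh_full (x :: l).
  apply: leq_trans full_big; apply: (@leq_trans (k * k + 2)).
    by rewrite addn2 !ltnS.
  by rewrite -addnA leq_add2l /k; lia.
suff: size ((x :: l) ++ [:: c]) < 4 by rewrite size_cat addn1 !ltnS.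
apply: (@hub_cycle a b) => //.
- by rewrite has_cat negb_or l_A has_seq1 full_notin.
- by rewrite cats1 rcons_uniq c_l.
- by rewrite size_cat /= addn1 -addn2; apply: leq_add => //; rewrite /k; lia.
- rewrite rcons_path; apply/andP; split=> //; apply/andP; split=> //.
  by rewrite adj_sym.
- move=> d d_A _; apply/and3P; split=> //; last exact: adj_full.
  by rewrite adj_sym; apply: adj_full.
Qed.

(** Two disjoint paths lead from the ends of the edge to [A]. Joined by the edge they form a path
    outside [A] attached to distinct vertices of [A], which by [short_detour] is just the edge
    itself. *)
Lemma edge_reps x y : x \notin A -> y \notin A -> adj G x y ->
  exists a b, [/\ a \in A, b \in A, a != b, adj G x a & adj G y b].
Proof.
move=> x_A y_A e_xy; have xy : x != y by apply: contraTneq e_xy => ->; rewrite adj_irr.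
have /card_gt1P[a0 [a1 [a0_A a1_A a01]]] : 1 < #|A| by rewrite card_A.
have con_x : connect (adj G) x a0.
  have x_a1 : x != a1 by apply: contraNneq x_A => ->.
  apply: connect_sub (G_2c.2 a1 x a0 x_a1 a01) => u v /and3P[e_uv _ _].
  exact: connect1.
have [z [r [Xz path_r uniq_r last_r [Xr Ar]]]] :=
  @path_between V (adj G) (pred2 x y) [in A] x a0 con_x (predU1l _ (erefl x)) a0_A.
have [z' [Xz' z'z]] : exists z', pred2 x y z' /\ z' != z.
  by case/orP: Xz => /eqP->; [exists y|exists x]; rewrite /= eqxx ?orbT // eq_sym.
have [b [b_A b_last]] : exists b, b \in A /\ b != last z r.
  have [eq_a0|neq_a0] := eqVneq a0 (last z r); last by exists a0.
  by exists a1; rewrite -eq_a0 eq_sym.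
have [u [l [v [l' [[Xu Xv z_uv] [path_l path_l'] uniq_ll' [last_l last_l'] [_ _ Al Al']]]]]] :=
  fan G_2c Xz Xz' z'z Xr path_r uniq_r last_r b_A b_last Ar.
have X_A w : pred2 x y w -> w \notin A by case/orP=> /eqP->.
have uv : u != v.
  by move: uniq_ll'; rewrite /= mem_cat inE !negb_or -!andbA => /and3P[].
have [l1 [c [def_l c_A Al1]]] : exists l1 c, [/\ l = rcons l1 c, c \in A & ~~ has [in A] (u :: l1)].
  case/lastP: l last_l Al {path_l uniq_ll'} => [|l1 c]; rewrite ?last_rcons ?belast_rcons.
    by move=> eq_u; have := X_A u Xu; rewrite [u]eq_u last_r.
  by move=> eq_c Al1; exists l1, c; split=> //; rewrite eq_c.
have [l2 [d [def_l' d_A Al2]]] : exists l1 c, [/\ l' = rcons l1 c, c \in A & ~~ has [in A] (v :: l1)].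
  case/lastP: l' last_l' Al' {path_l' uniq_ll'} => [|l1' d]; rewrite ?last_rcons ?belast_rcons.
    by move=> v_A; have := X_A v Xv; rewrite [v \in A]v_A.
  by move=> d_A Al2; exists l1', d.
move: path_l path_l' uniq_ll'; rewrite def_l def_l' !rcons_path => /andP[path_l1 e_c] /andP[path_l2 e_d].
rewrite -cat_cons -!rcons_cons cat_uniq !rcons_uniq => /and3P[/andP[_ uniq_l1] dis /andP[_ uniq_l2]].
have cd : c != d.
  apply: contraNneq dis => eq_cd; have c_l : c \in rcons (u :: l1) c.
    by rewrite mem_rcons mem_head.
  by apply/hasP; exists d; [rewrite mem_rcons mem_head | rewrite -{1}eq_cd].
have dis12 : ~~ has [in u :: l1] (v :: l2).
  apply: contra dis => /hasP[w w_l2 w_l1]; have w_l : w \in rcons (u :: l1) c.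
    by rewrite mem_rcons in_cons [w \in _]w_l1 orbT.
  by apply/hasP; exists w; rewrite // mem_rcons in_cons w_l2 orbT.
have e_uv : adj G u v.
  by move: Xu Xv uv => /= /orP[] /eqP -> /orP[] /eqP ->; rewrite ?eqxx // adj_sym.
have rev_l1 : rev (u :: l1) = last u l1 :: rev (belast u l1) by rewrite rev_belast.
have: size (rev (belast u l1) ++ v :: l2) <= 1.
  apply: (@short_detour (last u l1) _ c d) => //; rewrite -?cat_cons -?rev_l1.
  - by rewrite has_cat has_rev negb_or Al1.
  - rewrite cat_path path_rev //; last exact: adj_sym.
    by rewrite last_rev_belast andTb; apply/andP; split.
  - rewrite cat_uniq rev_uniq uniq_l1 uniq_l2 andbT.
    by apply: contra dis12; apply: sub_has => w; rewrite /= mem_rev.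
  - by rewrite last_cat last_rev_belast.
rewrite size_cat size_rev size_belast /= addnS ltnS leqn0 addn_eq0.
case/andP=> /eqP/size0nil l1_0 /eqP/size0nil l2_0.
rewrite l1_0 /= in e_c; rewrite l2_0 /= in e_d.
move: Xu Xv uv => /= /orP[] /eqP u_eq /orP[] /eqP v_eq; rewrite u_eq v_eq ?eqxx // => _.
  by exists c, d; split=> //; rewrite -?u_eq -?v_eq.
by exists d, c; split=> //; rewrite -?u_eq -?v_eq // eq_sym.
Qed.

Lemma no_fork x y z a b : x \notin A -> y \notin A -> z \notin A ->
  adj G x y -> adj G x z -> y != z -> a \in A -> b \in A ->
  adj G y a -> adj G z b -> a = b.
Proof.
move=> x_A y_A z_A e_xy e_xz yz a_A b_A e_ya e_zb; apply/eqP/negPn/negP => ab.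
have xy : x != y by apply: contraTneq e_xy => ->; rewrite adj_irr.
have xz : x != z by apply: contraTneq e_xz => ->; rewrite adj_irr.
have: size [:: x; z] <= 1; last by [].
apply: (@short_detour y _ a b) => //.
- by rewrite /= !negb_or y_A x_A z_A.
- by apply/and3P; split=> //; rewrite adj_sym.
- by rewrite /= !inE negb_or [y == x]eq_sym xy yz xz.
Qed.

Definition only_nbr x y := forall z, z \notin A -> adj G x z -> z = y.

(** If [x] has another neighbour [z] outside [A], then [no_fork] makes [y] and [z] attach to one and
    the same vertex of [A], so [y] is not full. A further neighbour [w] of [y] would give a triangle
    or a path on four vertices. *)
Lemma edge_leaf x y : x \notin A -> y \notin A -> adj G x y ->
  [\/ only_nbr x y /\ x \notin full, only_nbr y x /\ y \notin full
    | x \in full /\ y \in full].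
Proof.
wlog: x y / exists z, [/\ z \notin A, adj G x z & z != y].
  move=> hyp x_A y_A e_xy.
  have [x_z|no_x] := pselect (exists z, [/\ z \notin A, adj G x z & z != y]).
    exact: hyp.
  have [y_z|no_y] := pselect (exists z, [/\ z \notin A, adj G y z & z != x]).
    have [|||] := hyp y x y_z y_A x_A; first by rewrite adj_sym.
    - by constructor 2.
    - by constructor 1.
    - by case=> y_full x_full; constructor 3.
  have x_y : only_nbr x y.
    move=> z z_A e_xz; apply/eqP/negPn/negP => zy; apply: no_x; by exists z.
  have y_x : only_nbr y x.
    move=> z z_A e_yz; apply/eqP/negPn/negP => zx; apply: no_y; by exists z.
  have [x_full|x_full] := boolP (x \in full); last by constructor 1.
  have [y_full|y_full] := boolP (y \in full); last by constructor 2.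
  by constructor 3.
move=> [z [z_A e_xz zy]] x_A y_A e_xy; constructor 2.
have yz : y != z by rewrite eq_sym.
have e_yx : adj G y x by rewrite adj_sym.
have [a [b [a_A b_A ab e_xa e_yb]]] := edge_reps x_A y_A e_xy.
have [_ [c [_ c_A _ _ e_zc]]] := edge_reps x_A z_A e_xz.
split; last first.
  apply/negP => y_full; have := no_fork x_A y_A z_A e_xy e_xz yz a_A c_A (adj_full y_full a_A) e_zc.
  have := no_fork x_A y_A z_A e_xy e_xz yz b_A c_A e_yb e_zc.
  by move=> b_c a_c; rewrite a_c b_c eqxx in ab.
move=> w w_A e_yw; apply/eqP/negPn/negP => wx; have xw : x != w by rewrite eq_sym.
(* In a triangle, [edge_reps] for the edge between [y] and [z] yields distinct attachments, against
   [no_fork]. *)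
have [w_z|wz] := eqVneq w z.
  rewrite w_z in e_yw; have [d [d' [d_A d'_A dd' e_yd e_zd']]] := edge_reps y_A z_A e_yw.
  by rewrite (no_fork x_A y_A z_A e_xy e_xz yz d_A d'_A e_yd e_zd') eqxx in dd'.
have [_ [d [_ d_A _ _ e_wd]]] := edge_reps y_A w_A e_yw.
have b_c := no_fork x_A y_A z_A e_xy e_xz yz b_A c_A e_yb e_zc.
have a_d := no_fork y_A x_A w_A e_yx e_yw xw a_A d_A e_xa e_wd.
(* The path z, x, y, w has attachments [c = b] and [d = a] at its ends, and [a != b]. *)
have: size [:: x; y; w] <= 1; last by [].
have xz : x != z by apply: contraTneq e_xz => ->; rewrite adj_irr.
have xy : x != y by apply: contraTneq e_xy => ->; rewrite adj_irr.
have yw : y != w by apply: contraTneq e_yw => ->; rewrite adj_irr.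
apply: (@short_detour z _ c d) => //.
- by rewrite /= !negb_or z_A x_A y_A w_A.
- by apply/and4P; split=> //; rewrite adj_sym.
- rewrite /= !inE !negb_or [z == x]eq_sym xz zy [z == w]eq_sym wz xy xw yw.
  by [].
- by rewrite -b_c -a_d eq_sym.
Qed.

(** Two edges sharing an end make a fork; two disjoint ones serve as [P0] and [P1] in [hub_cycle],
    with four vertices in all. *)
Lemma full_edge_unique x y x' y' : x \in full -> y \in full -> adj G x y ->
  x' \in full -> y' \in full -> adj G x' y' -> [set x; y] = [set x'; y'].
Proof.
move=> x_f y_f e_xy x'_f y'_f e_xy'.
have /card_gt1P[a0 [a1 [a0_A a1_A a01]]] : 1 < #|A| by rewrite card_A.
have share u v w : u \in full -> v \in full -> w \in full -> adj G u v -> adj G u w -> v = w.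
  move=> u_f v_f w_f e_uv e_uw; apply/eqP/negPn/negP => vw.
  have := no_fork (full_notin u_f) (full_notin v_f) (full_notin w_f) e_uv e_uw vw
    a0_A a1_A (adj_full v_f a0_A) (adj_full w_f a1_A).
  by move=> a_eq; rewrite a_eq eqxx in a01.
have [x_x'|x_x'] := eqVneq x x'.
  by rewrite -x_x' in e_xy' *; rewrite (share x y y').
have [x_y'|x_y'] := eqVneq x y'.
  by rewrite -x_y' adj_sym in e_xy' *; rewrite (share x y x') // setUC.
have [y_x'|y_x'] := eqVneq y x'.
  by rewrite -y_x' in e_xy' *; rewrite adj_sym in e_xy; rewrite (share y x y') // setUC.
have [y_y'|y_y'] := eqVneq y y'.
  by rewrite -y_y' adj_sym in e_xy' *; rewrite adj_sym in e_xy; rewrite (share y x x').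
have xy : x != y by apply: contraTneq e_xy => ->; rewrite adj_irr.
have xy' : x' != y' by apply: contraTneq e_xy' => ->; rewrite adj_irr.
have: size ([:: x; y] ++ [:: x'; y']) < 4; last by [].
apply: (@hub_cycle a0 a1) => //.
- by rewrite /= !negb_or !full_notin.
- by rewrite /= !inE !negb_or xy x_x' x_y' y_x' y_y' xy'.
- by apply: leq_trans (leq_addl _ _); rewrite /k /=; move: t_gt1; clear; lia.
- by apply/and4P; split=> //; [rewrite adj_sym|]; apply: adj_full.
- by move=> b b_A _; apply/and4P; split=> //; [rewrite adj_sym|]; apply: adj_full.
Qed.

Lemma card_full_edges : #|[set f in edges G | f \subset full]| <= 1.
Proof.
apply/card_le1_eqP => f g; rewrite !inE => /andP[f_G f_full] /andP[g_G g_full].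
have [x [y [_ def_f e_xy]]] := edgeP f_G; have [z [w [_ def_g e_zw]]] := edgeP g_G.
move: f_full g_full; rewrite def_f def_g !subUset !sub1set => /andP[x_f y_f] /andP[z_f w_f].
exact: full_edge_unique.
Qed.

Lemma card_edges_hub :
  #|edges G| <= #|[set f in edges G | f \subset A]| + t * (#|V| - t)
                + #|[set f in edges G | f \subset full]|.
Proof.
pose inner v := [set u in A | adj G v u].
pose outer v := [set u in ~: A | adj G v u].
(* The extra edge is charged only to a vertex that misses part of [A], so that [t] still bounds the
   charge. *)
pose charge v : {set {set V}} := [set [set u; v] | u in inner v] :|:
  (if (v \notin full) && (#|outer v| <= 1)
   then [set [set u; v] | u in outer v] else set0).
have charge_t v : #|charge v| <= t.
  apply: leq_trans (leq_card_setU _ _) _.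
  have inner_A : inner v \subset A by apply/subsetP => u; rewrite inE => /andP[].
  have card_inner : #|[set [set u; v] | u in inner v]| <= #|inner v| by apply: leq_imset_card.
  case: ifP => [/andP[v_full outer1]|_]; last first.
    by rewrite cards0 addn0 (leq_trans card_inner) // -card_A subset_leq_card.
  have inner_lt : #|inner v| < t.
    rewrite -card_A proper_card // properEneq inner_A andbT.
    apply: contraNneq v_full => inner_eq; rewrite inE -{1}inner_eq.
    by apply/subsetP => u; rewrite !inE => /andP[].
  rewrite (leq_trans _ inner_lt) // -addn1 leq_add //.
  exact: leq_trans (leq_imset_card _ _) outer1.
have sub_charge : edges G \subset ([set f in edges G | f \subset A]
    :|: \bigcup_(v in ~: A) charge v) :|: [set f in edges G | f \subset full].
  have in_charge x y : y \notin A -> adj G x y -> x \in A \/ only_nbr y x /\ y \notin full ->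
      [set x; y] \in \bigcup_(v in ~: A) charge v.
    move=> y_A e_xy x_y; apply/bigcupP; exists y; first by rewrite inE.
    have e_yx : adj G y x by rewrite adj_sym.
    have [x_A|x_A] := boolP (x \in A).
      by rewrite inE; apply/orP; left; apply/imsetP; exists x; rewrite // inE x_A.
    case: x_y => [x_A'|[y_x y_full]]; first by rewrite x_A' in x_A.
    rewrite inE; apply/orP; right; rewrite y_full.
    have -> : #|outer y| <= 1.
      apply/card_le1_eqP => u w; rewrite !inE => /andP[u_A e_yu] /andP[w_A e_yw].
      by rewrite (y_x u) // (y_x w).
    by apply/imsetP; exists x; rewrite // inE in_setC x_A.
  apply/subsetP => f f_G; have [x [y [x_y def_f e_xy]]] := edgeP f_G.
  rewrite !in_setU; have [f_A|f_A] := boolP (f \in [set f in edges G | f \subset A]).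
    by [].
  have [f_f|f_f] := boolP (f \in [set f in edges G | f \subset full]); first by rewrite orbT.
  rewrite orbF /=; rewrite !inE f_G def_f !subUset !sub1set /= in f_A f_f *.
  have e_yx : adj G y x by rewrite adj_sym.
  have [x_A|x_A] := boolP (x \in A).
    by apply: in_charge => //; [move: f_A; rewrite x_A | left].
  have [y_A|y_A] := boolP (y \in A).
    by rewrite setUC; apply: in_charge => //; left.
  have [x_leaf|y_leaf|[x_full y_full]] := edge_leaf x_A y_A e_xy.
  - by rewrite setUC; apply: in_charge => //; right.
  - by apply: in_charge => //; right.
  - by rewrite x_full y_full in f_f.
apply: leq_trans (subset_leq_card sub_charge) _.
apply: leq_trans (leq_card_setU _ _) _; rewrite leq_add2r.
apply: leq_trans (leq_card_setU _ _) _; rewrite leq_add2l.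
apply: leq_trans (card_bigcup_le _ _) _.
have -> : #|V| - t = #|~: A| by rewrite cardsCs setCK card_A.
by rewrite mulnC -sum_nat_const; apply: leq_sum => v _; apply: charge_t.
Qed.

End Hub.

(** * Joins with an independent set *)

Lemma connect_homo (T T' : finType) (r : rel T) (r' : rel T') (f : T -> T') :
  {homo f : x y / r x y >-> r' x y} ->
  {homo f : x y / connect r x y >-> connect r' x y}.
Proof.
move=> f_r x y /connectP[l path_l ->]; apply/connectP; exists (map f l).
  exact: homo_path path_l.
by rewrite last_map.
Qed.

Lemma adj_induced (T : finType) (G : graph T) (S : {set T}) (x y : {x | x \in S}) :
  adj (induced G S) x y = adj G (val x) (val y).
Proof. by rewrite /adj /= inE imsetU1 imset_set1. Qed.

Lemma two_connectedW (T : finType) (G : graph T) :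
  two_connected G -> two_conn (adj G).
Proof.
case/and3P=> T_gt2 _ /forallP conn; split=> // v x y x_v y_v.
have memC z : z != v -> z \in [set~ v] by rewrite !inE.
have /forallP/(_ (exist _ x (memC x x_v)))/forallP := conn v.
move=> /(_ (exist _ y (memC y y_v))).
apply: (@connect_homo _ _ _ (del (adj G) v) val) => a b; rewrite adj_induced => e_ab.
by apply/and3P; split; rewrite // -in_setC1 ?(valP a) ?(valP b).
Qed.

Lemma contains_cycle (T : finType) (G : graph T) c :
  2 < size c -> uniq c -> cycle (adj G) c -> contains G (cycle_graph (size c)).
Proof.
move=> size_c uniq_c cycle_c; exists (tnth (in_tuple c)); split.
  exact/tuple_uniqP.
have e_next (i : 'I_(size c)) : adj G (tnth (in_tuple c) i) (tnth (in_tuple c) (ordS i)).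
  case def_c: c size_c uniq_c cycle_c i => [//|x s] _ uniq_xs cycle_xs i.
  rewrite !(tnth_nth x) /=; have i_lt : i < size (x :: s) by apply: ltn_ord.
  have i_c : nth x (x :: s) i \in x :: s by rewrite mem_nth.
  have := next_cycle cycle_xs i_c; rewrite next_nth i_c index_uniq //.
  (* At the last index the default value [x] of [nth] is the vertex to which the cycle wraps
     around. *)
  suff -> : nth x (x :: s) (i.+1 %% size (x :: s)) = nth x s i by [].
  have [i_eq|i_neq] := eqVneq i.+1 (size (x :: s)).
    by rewrite i_eq modnn [RHS]nth_default //; case: i_eq => ->.
  by rewrite modn_small // ltn_neqAle i_neq.
move=> i j; rewrite {1}/adj /= inE => /andP[_ /existsP[l /eqP/eq_set2]].
by case=> -[-> ->]; rewrite // adj_sym.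
Qed.

Lemma free_no_long_cycle (T U : finType) (G : graph T) (F : graph U) k :
  2 < k -> free (adjoin (cycles_ge k) F) G -> no_long_cycle (adj G) k.
Proof.
move=> k_gt2 G_free c uniq_c cycle_c; rewrite ltnNge; apply/negP => size_c.
have size_c3 := leq_trans k_gt2 size_c.
apply: (G_free _ (cycle_graph (size c))); last exact: contains_cycle.
by apply: AdjoinOld; apply: CyclesGe.
Qed.

(** Serves both for a covering [S], with an independent rest, and for an [S] whose complement is the
    two ends of an edge. *)
Lemma contains_extend (T V : finType) (F : graph T) (G : graph V) (S : {set T})
    (g : {x | x \in S} -> V) (h : T -> V) :
  injective g -> {in ~: S &, injective h} ->
  (forall x s, x \in ~: S -> h x != g s /\ adj G (h x) (g s)) ->
  (forall s s', adj (induced F S) s s' -> adj G (g s) (g s')) ->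
  {in ~: S &, forall x y, adj F x y -> adj G (h x) (h y)} ->
  contains G F.
Proof.
move=> g_inj h_inj h_g g_adj h_adj.
pose f x := if insub x is Some s then g s else h x.
have fS s : f (val s) = g s by rewrite /f valK.
have fC x : x \in ~: S -> f x = h x by rewrite inE /f => x_S; rewrite insubN.
have split_x x : x \in ~: S \/ exists s : {x | x \in S}, x = val s.
  have [x_S|x_S] := boolP (x \in S); last by left; rewrite inE.
  by right; exists (exist _ x x_S).
exists f; split=> x y.
  case: (split_x x) => [x_S|[s ->]]; case: (split_x y) => [y_S|[s' ->]]; rewrite ?fS ?fC //.
  - exact: h_inj.
  - by move=> eq_h; have [/eqP] := h_g x s' x_S.
  - by move=> eq_h; have [/eqP] := h_g y s y_S; rewrite eq_h.
  - by move/g_inj ->.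
case: (split_x x) => [x_S|[s ->]]; case: (split_x y) => [y_S|[s' ->]]; rewrite ?fS ?fC //.
- exact: h_adj.
- by have [] := h_g x s' x_S.
- by rewrite [adj G _ _]adj_sym; have [] := h_g y s y_S.
- by rewrite -adj_induced; apply: g_adj.
Qed.

Lemma connected_join (W : finType) (H : graph W) (P : {set W}) a b :
  a \in P -> b \notin P ->
  {in P & ~: P, forall x y, adj H x y} -> connected H.
Proof.
move=> a_P b_P H_P; have P_b x : x \in P -> connect (adj H) x b.
  by move=> x_P; apply: connect1; apply: H_P; rewrite ?inE.
have b_P' x : x \in P -> connect (adj H) b x.
  by move=> x_P; apply: connect1; rewrite adj_sym; apply: H_P; rewrite ?inE.
have to_b x : connect (adj H) x b /\ connect (adj H) b x.
  have [x_P|x_P] := boolP (x \in P); first by split; [apply: P_b|apply: b_P'].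
  split.
    apply: connect_trans (P_b a a_P); apply: connect1; rewrite adj_sym.
    by apply: H_P; rewrite ?inE.
  apply: connect_trans (b_P' a a_P) _; apply: connect1.
  by apply: H_P; rewrite ?inE.
apply/forallP => x; apply/forallP => y.
exact: connect_trans (to_b x).1 (to_b y).2.
Qed.

Section Join.

Variables (n t : nat) (G0 : graph 'I_t).

(** [insub] succeeds exactly on the vertices below [t], which carry [G0]; the remaining ones are
    independent and joined to all of these. *)
Definition join_rel : rel 'I_n := fun x y =>
  match insub (val x) : option 'I_t, insub (val y) : option 'I_t with
  | Some a, Some b => adj G0 a b
  | None, None => false
  | _, _ => true
  end.

Definition join_edges : {set {set 'I_n}} :=
  [set f : {set 'I_n} | [exists x, exists y, (f == [set x; y]) && join_rel x y]].

Lemma join_rel_sym : symmetric join_rel.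
Proof. by move=> x y; rewrite /join_rel; do 2!case: insub => // ?; rewrite adj_sym. Qed.

Lemma join_rel_irr : irreflexive join_rel.
Proof. by move=> x; rewrite /join_rel; case: insub => // a; rewrite adj_irr. Qed.

Lemma join_card2 : join_edges \subset [set e : {set _} | #|e| == 2].
Proof.
apply/subsetP => f; rewrite !inE => /existsP[x /existsP[y /andP[/eqP-> xy]]].
by rewrite cards2; have -> : x != y by apply: contraTneq xy => ->; rewrite join_rel_irr.
Qed.

Definition join_independent : graph 'I_n := Graph join_card2.

Lemma adj_join : adj join_independent =2 join_rel.
Proof.
move=> x y; rewrite /adj /= inE; apply/existsP/idP => [[a /existsP[b /andP[/eqP]]]|xy].
  by case/eq_set2=> -[-> ->] //; rewrite join_rel_sym.
by exists x; apply/existsP; exists y; rewrite eqxx.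
Qed.

Let lo : {set 'I_n} := [set x : 'I_n | x < t].

Lemma join_hi x y : x \notin lo -> y \notin lo -> ~~ join_rel x y.
Proof. by rewrite !inE /join_rel => x_t y_t; rewrite !insubN. Qed.

Lemma join_lo_hi : {in lo & ~: lo, forall x y, join_rel x y}.
Proof.
move=> x y; rewrite !inE /join_rel => x_t y_t.
by rewrite insubT insubN.
Qed.

Lemma join_lo (x y : 'I_n) (x_t : x < t) (y_t : y < t) :
  join_rel x y = adj G0 (Ordinal x_t) (Ordinal y_t).
Proof. by rewrite /join_rel !insubT. Qed.

Hypothesis t_n : t + 2 <= n.

Lemma card_lo : #|lo| = t.
Proof.
have t_le_n : t <= n by lia.
have -> : lo = [set widen_ord t_le_n a | a in 'I_t].
  apply/setP => x; rewrite inE; apply/idP/imsetP => [x_t|[a _ ->]].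
    by exists (Ordinal x_t) => //; apply: val_inj.
  exact: (ltn_ord a).
rewrite card_imset ?card_ord // => a b /(congr1 val) /= ab.
exact: val_inj.
Qed.

(** Both sides of the join have at least two vertices, so deleting one vertex empties neither. *)
Lemma join_two_connected : 1 < t -> two_connected join_independent.
Proof.
move=> t_gt1.
have lo_hi : {in lo & ~: lo, forall x y, adj join_independent x y}.
  by move=> x y x_lo y_lo; rewrite adj_join join_lo_hi.
have pick_out (S : {set 'I_n}) v : 1 < #|S| -> exists2 a, a \in S & a \in [set~ v].
  move=> S_gt1; have : 0 < #|S :\ v| by have := cardsD1 v S; case: (v \in S); lia.
  by case/card_gt0P => a; rewrite inE => /andP[a_v a_S]; exists a; rewrite ?inE // in a_v *.
have lo_gt1 : 1 < #|lo| by rewrite card_lo.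
have hi_gt1 : 1 < #|~: lo|.
  by have := cardsC lo; rewrite card_ord card_lo; lia.
apply/and3P; split.
- by rewrite card_ord; lia.
- have /card_gt0P[a a_lo] : 0 < #|lo| by apply: ltnW.
  have /card_gt0P[b b_hi] : 0 < #|~: lo| by apply: ltnW.
  by rewrite in_setC in b_hi; apply: connected_join a_lo b_hi lo_hi.
apply/forallP => v; have [a a_lo a_v] := pick_out lo v lo_gt1.
have [b b_hi b_v] := pick_out _ v hi_gt1.
apply: (@connected_join _ _ [set x | val x \in lo] (exist _ a a_v) (exist _ b b_v)).
- by rewrite inE.
- by rewrite inE /=; rewrite in_setC in b_hi.
- move=> x y; rewrite in_setC [x \in _]in_set [y \in _]in_set => x_lo y_lo.
  by rewrite adj_induced; apply: lo_hi; rewrite // in_setC.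
Qed.

Lemma join_edges_card : #|edges G0| + t * (n - t) <= #|edges join_independent|.
Proof.
have t_le_n : t <= n by lia.
pose w := widen_ord t_le_n.
have w_inj : injective w by move=> a b /(congr1 val) /= ab; apply: val_inj.
pose E0 : {set {set 'I_n}} := [set w @: f | f : {set 'I_t} in edges G0].
pose E1 : {set {set 'I_n}} := [set [set xy.1; xy.2] | xy in setX lo (~: lo)].
have w_lo a : w a \in lo by rewrite inE /=.
have card_E0 : #|E0| = #|edges G0|.
  by rewrite card_imset //; apply: imset_inj.
have card_E1 : #|E1| = t * (n - t).
  rewrite card_in_imset.
    by rewrite cardsX card_lo cardsCs setCK card_ord card_lo.
  move=> [x y] [x' y']; rewrite !in_setX /= !in_setC => /andP[x_lo y_lo] /andP[x'_lo y'_lo].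
  by case/eq_set2=> -[eq_x eq_y]; [rewrite eq_x eq_y | rewrite -eq_x x_lo in y'_lo].
have disj : [disjoint E0 & E1].
  rewrite -setI_eq0; apply/eqP/setP => f; rewrite !inE; apply/negP.
  case/andP=> /imsetP[f0 _ ->] /imsetP[[x y]]; rewrite in_setX in_setC /=.
  move=> /andP[_ y_lo] /setP/(_ y); rewrite !inE eqxx orbT => /imsetP[a _ y_a].
  by rewrite y_a w_lo in y_lo.
rewrite -card_E0 -card_E1 -cardsUI.
have -> : E0 :&: E1 = set0 by apply/eqP; rewrite setI_eq0.
rewrite cards0 addn0; apply: subset_leq_card; rewrite subUset; apply/andP; split.
  apply/subsetP => _ /imsetP[f /edgeP[a [b [_ -> ab]]] ->].
  rewrite imsetU1 imset_set1 -[_ \in _]/(adj join_independent (w a) (w b)).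
  rewrite adj_join (@join_lo (w a) (w b) (ltn_ord a) (ltn_ord b)).
  by congr (adj _ _ _) : ab; apply: val_inj.
apply/subsetP => _ /imsetP[[x y] xy ->]; move: xy; rewrite in_setX /= => /andP[x_lo y_hi].
by rewrite -[_ \in _]/(adj join_independent x y) adj_join join_lo_hi.
Qed.

(** Cycle vertices outside the first [t] are followed by ones inside, so at least half of the cycle
    lies among the first [t] vertices. *)
Lemma join_no_cycle m : 2 < m -> t.*2 < m -> ~ contains join_independent (cycle_graph m).
Proof.
move=> m_gt2 m_t [f [f_inj f_adj]].
pose I := [set i | f i \in lo].
have card_I : #|I| <= t.
  rewrite -card_lo -(card_imset I f_inj); apply: subset_leq_card.
  by apply/subsetP => _ /imsetP[i i_I ->]; rewrite inE in i_I.
have I_next i : i \notin I -> ordS i \in I.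
  move=> i_I; apply/negPn/negP => Si_I.
  have: adj (cycle_graph m) i (ordS i).
    rewrite /adj /= inE; apply/andP; split; last by apply/existsP; exists i.
    rewrite cards2; suff -> : i != ordS i by [].
    apply/eqP => /(congr1 val) /=.
    have [i_lt|i_ge] := ltnP i.+1 m; first by rewrite modn_small //; lia.
    have i_m : i.+1 = m by apply/eqP; rewrite eqn_leq i_ge ltn_ord.
    by rewrite i_m modnn; lia.
  move/f_adj; rewrite adj_join; apply/negP; apply: join_hi.
    by move: i_I; rewrite inE.
  by move: Si_I; rewrite inE.
have : #|~: I| <= #|I|.
  rewrite -(card_imset _ (@ordS_inj m)); apply: subset_leq_card.
  by apply/subsetP => _ /imsetP[i i_I ->]; apply: I_next; rewrite -in_setC.
by have := cardsC I; rewrite card_ord; lia.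
Qed.

(** The vertices of a copy of [F] lying among the first [t] form a covering, as the others are
    independent. *)
Lemma join_free (T : finType) (F : graph T) :
  free (covering_family F) G0 -> ~ contains join_independent F.
Proof.
move=> G0_free [f [f_inj f_adj]]; pose S := [set x | f x \in lo].
apply: (G0_free _ (induced F S)).
  constructor; apply/forall_inP => x; rewrite in_setC inE => x_S.
  apply/forall_inP => y; rewrite in_setC inE => y_S; apply/negP => /f_adj.
  by rewrite adj_join; apply/negP; apply: join_hi.
have f_lo (s : {x | x \in S}) : f (val s) < t.
  by have := valP s; rewrite !inE.
exists (fun s => Ordinal (f_lo s)); split=> [s s' [] /val_inj/f_inj/val_inj //|s s'].
by rewrite adj_induced => /f_adj; rewrite adj_join join_lo.
Qed.

End Join.

(** * The extremal number *)

Lemma color_class_card (T : finType) (F : graph T) m (S : {set T}) :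
  le_inf m (p F) -> color_class F S -> m <= #|S|.
Proof.
rewrite /p => m_p F_S; case: pickP m_p => [A0 F_A0|none]; last by rewrite none in F_S.
by case: arg_minnP => // A _ /(_ S F_S) A_min /leq_trans; apply.
Qed.

Lemma exists_EX n (Fam : Defs.family) (G : graph 'I_n) :
  free Fam G -> exists G', G' \in EX n Fam.
Proof.
move=> G_free.
have [|G' G'_free G'_max] := @eq_bigmax_cond _ [pred G : graph 'I_n | `[< free Fam G >]]
    (fun G => #|edges G|).
  by apply/card_gt0P; exists G; apply/asboolP.
by exists G'; rewrite inE; apply/andP; split; rewrite //= /ex -G'_max.
Qed.

Lemma empty_card2 (T : finType) :
  (set0 : {set {set T}}) \subset [set e : {set _} | #|e| == 2].
Proof. exact: sub0set. Qed.

Definition empty_graph (T : finType) : graph T := Graph (@empty_card2 T).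

(** A covering whose induced graph embeds here is itself independent, hence a color class with at
    most [t] vertices, against the bound on [p F]. Thus the maximum [ex t (covering_family F)] is
    taken over a nonempty set. *)
Lemma empty_free_covering (T : finType) (F : graph T) t :
  le_inf (t + 1) (p F) -> free (covering_family F) (empty_graph 'I_t).
Proof.
move=> pF U H [S F_S] [f [f_inj f_adj]].
have S_indep x y : x \in S -> y \in S -> ~~ adj F x y.
  move=> x_S y_S; apply/negP => xy; have := f_adj (exist _ x x_S) (exist _ y y_S).
  by rewrite adj_induced => /(_ xy); rewrite /adj /= inE.
have card_S : #|S| <= t.
  have := leq_card f f_inj; rewrite card_ord card_sig.
  by apply: leq_trans; apply: subset_leq_card; apply/subsetP => x; rewrite inE.
have: t + 1 <= #|S|.
  apply: color_class_card pF _; apply/existsP; exists [ffun x => x \in S].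
  apply/existsP; exists true; apply/andP; split; last first.
    by apply/eqP/setP => x; rewrite inE ffunE eqb_id.
  apply/forallP => x; apply/forallP => y; apply/implyP => xy; rewrite !ffunE.
  have [x_S|x_S] := boolP (x \in S); have [y_S|y_S] := boolP (y \in S) => //.
    by have := S_indep x y x_S y_S; rewrite xy.
  rewrite -in_setC in x_S; rewrite -in_setC in y_S.
  by have := forall_inP (forall_inP F_S x x_S) y y_S; rewrite xy.
by rewrite addn1 ltnNge card_S.
Qed.

Lemma induced_on_ord (V : finType) (G : graph V) (A : {set V}) t : #|A| = t ->
  exists (G' : graph 'I_t) (h : 'I_t -> V),
  [/\ injective h, forall i, h i \in A, forall i j, adj G' i j = adj G (h i) (h j)
    & #|[set f in edges G | f \subset A]| = #|edges G'|].
Proof.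
move=> card_A; pose h (i : 'I_t) := enum_val (cast_ord (esym card_A) i).
have h_inj : injective h by move=> i j /enum_val_inj/cast_ord_inj.
have h_A i : h i \in A by apply: enum_valP.
pose E : {set {set 'I_t}} := [set f : {set 'I_t} | h @: f \in edges G].
have E2 : E \subset [set e : {set _} | #|e| == 2].
  apply/subsetP => f; rewrite !inE => /(subsetP (edges_card2 G)).
  by rewrite inE card_imset.
exists (Graph E2), h; split=> //.
  by move=> i j; rewrite /adj /= inE imsetU1 imset_set1.
rewrite -(card_imset (mem E) (imset_inj h_inj)); congr #|pred_of_set _|.
apply/setP => f; rewrite inE; apply/andP/imsetP => [[f_G f_A]|[f0 f0_E ->]].
  have def_f : f = h @: (h @^-1: f).
    apply/setP => x; apply/idP/imsetP => [x_f|[i]]; last by rewrite inE => h_f ->.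
    have x_A := subsetP f_A x x_f.
    have hx : h (cast_ord card_A (enum_rank_in x_A x)) = x.
      by rewrite /h cast_ordK enum_rankK_in.
    by exists (cast_ord card_A (enum_rank_in x_A x)); rewrite ?inE hx.
  by exists (h @^-1: f) => //; rewrite inE -def_f.
rewrite inE in f0_E; split=> //.
by apply/subsetP => _ /imsetP[i _ ->].
Qed.

(** The vertices outside the covering are independent, so any distinct vertices of [D] can represent
    them. *)
Lemma hub_contains_covering (T V : finType) (F : graph T) (G : graph V) t (A D : {set V})
    (G' : graph 'I_t) (h : 'I_t -> V) (U : finType) (H : graph U) :
  injective h -> (forall i, h i \in A) -> (forall i j, adj G' i j = adj G (h i) (h j)) ->
  #|T| <= #|D| -> {in D & A, forall v a, adj G v a} ->
  covering_family F H -> contains G' H -> contains G F.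
Proof.
move=> h_inj h_A h_adj T_D D_A [S F_S] [f [f_inj f_adj]].
pose d (x : T) := enum_val (widen_ord T_D (enum_rank x)).
have d_D x : d x \in D by apply: enum_valP.
apply: (@contains_extend _ _ F G S (h \o f) d).
- exact: inj_comp.
- by move=> x y _ _ /enum_val_inj/(congr1 val)/= /val_inj/enum_rank_inj.
- move=> x s _; have e_xs := D_A _ _ (d_D x) (h_A (f s)); split=> //.
  by apply: contraTneq e_xs => ->; rewrite adj_irr.
- by move=> s s' /f_adj; rewrite h_adj.
move=> x y x_S y_S; apply: contraTT => _.
exact: (forall_inP (forall_inP F_S x x_S) y y_S).
Qed.

Lemma edge_contains_deleted (T V : finType) (F : graph T) (G : graph V) t (A : {set V})
    (G' : graph 'I_t) (h : 'I_t -> V) (U : finType) (H : graph U) x y :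
  injective h -> (forall i, h i \in A) -> (forall i j, adj G' i j = adj G (h i) (h j)) ->
  adj G x y -> {in [set x; y] & A, forall v a, adj G v a} ->
  edge_deleted_family F H -> contains G' H -> contains G F.
Proof.
move=> h_inj h_A h_adj e_xy xy_A [u v e_uv] [f [f_inj f_adj]].
have xy : x != y by apply: contraTneq e_xy => ->; rewrite adj_irr.
have uv : u != v by apply: contraTneq e_uv => ->; rewrite adj_irr.
pose d z := if z == u then x else y.
have d_xy z : d z \in [set x; y] by rewrite /d !inE; case: ifP; rewrite eqxx ?orbT.
apply: (@contains_extend _ _ F G _ (h \o f) d).
- exact: inj_comp.
- move=> z w; rewrite setCK !inE /d => /orP[] /eqP -> /orP[] /eqP -> //.
  + by rewrite eqxx [v == u]eq_sym (negbTE uv) => eq_xy; rewrite eq_xy eqxx in xy.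
  + by rewrite eqxx [v == u]eq_sym (negbTE uv) => eq_xy; rewrite eq_xy eqxx in xy.
- move=> z s _; have e_zs := xy_A _ _ (d_xy z) (h_A (f s)); split=> //.
  by apply: contraTneq e_zs => ->; rewrite adj_irr.
- by move=> s s' /f_adj; rewrite h_adj.
move=> z w; rewrite setCK !inE /d => /orP[] /eqP -> /orP[] /eqP ->.
- by rewrite adj_irr.
- by rewrite eqxx [v == u]eq_sym (negbTE uv).
- by rewrite eqxx [v == u]eq_sym (negbTE uv) [adj G y x]adj_sym.
- by rewrite adj_irr.
Qed.

Lemma two_connected_free_edges (T : finType) (F : graph T) t : 1 < t ->
  exists n0, forall n, n0 <= n -> forall G : graph 'I_n,
  two_connected G -> free (adjoin (cycles_ge (t.*2 + 2)) F) G ->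
  let m := ex t (covering_family F) + t * (n - t) in
  #|edges G| <= m \/
  #|edges G| = m + 1 /\ exists2 G' : graph 'I_t, G' \in EX t (covering_family F) &
    forall (U : finType) (H : graph U), edge_deleted_family F H -> ~ contains G' H.
Proof.
move=> t_gt1; set k := t.*2 + 2.
(* The first three summands are the size required of the common neighbourhood for the structure
   lemmas; [#|T|] leaves room for the vertices of [F] outside a covering. *)
have [n0 biclique] := dense_biclique (k * k + k + k + #|T|) (ltnW t_gt1).
exists n0 => n n_big G /two_connectedW G_2c G_free m.
have k_gt2 : 2 < k by rewrite /k; lia.
have G_k := free_no_long_cycle k_gt2 G_free.
have G_F : ~ contains G F by apply: G_free; apply: AdjoinNew.
have [|m_lt] := leqP #|edges G| m; [by left | right].
have [||A [card_A A_full]] := biclique _ G _ G_2c G_k.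
- by rewrite card_ord.
- by rewrite card_ord; apply: leq_trans (ltnW m_lt); apply: leq_addl.
set full := [set v | _] in A_full.
have full_big := leq_trans (leq_addr _ _) A_full.
have full_A : {in full & A, forall v a, adj G v a} by move=> v a; apply: adj_full.
have [G' [h [h_inj h_A h_adj card_G']]] := induced_on_ord G card_A.
have G'_free : free (covering_family F) G'.
  move=> U H F_H H_G'; apply: G_F.
  apply: hub_contains_covering h_inj h_A h_adj _ full_A F_H H_G'.
  exact: leq_trans (leq_addl _ _) A_full.
have G'_ex : #|edges G'| <= ex t (covering_family F).
  by apply: (@leq_bigmax_cond _ _ (fun G => #|edges G|)); apply/asboolP.
have := card_edges_hub t_gt1 card_A G_2c G_k full_big.
have := card_full_edges t_gt1 card_A G_2c G_k full_big.
rewrite card_G' card_ord -/full; set full_edges := [set f in _ | _] => full1 G_le.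
(* More than [m] edges force the exceptional edge to exist and every estimate to be tight, so [G']
   is extremal. *)
have [f f_full] : exists f, f \in full_edges.
  by apply/card_gt0P; move: m_lt; rewrite /m; lia.
split; first by move: m_lt; rewrite /m; lia.
exists G'.
  rewrite inE; apply/andP; split; first exact/asboolP.
  by apply/eqP; move: m_lt; rewrite /m; lia.
move=> U H F_H H_G'; apply: G_F.
move: f_full; rewrite inE => /andP[/edgeP[x [y [_ -> e_xy]]] xy_full].
apply: edge_contains_deleted h_inj h_A h_adj e_xy _ F_H H_G'.
by move=> v a /(subsetP xy_full); apply: full_A.
Qed.

Theorem theorem5 (k t : nat) (T : finType) (F : graph T)
    (k_ge6 : 6 <= k) (k_even : ~~ odd k) (tE : t = (k - 1) %/ 2)
    (pF : le_inf (t + 1) (p F)) :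
  exists n0 : nat, forall n : nat, n0 <= n ->
    exists l : nat,
      (l = 0 \/ l = 1) /\
      ex_2conn n (adjoin (cycles_ge k) F)
        = ex t (covering_family F) + t * (n - t) + l /\
      ((forall G : graph 'I_t, G \in EX t (covering_family F) ->
          exists (U : finType) (H : graph U),
            edge_deleted_family F H /\ contains G H) ->
       l = 0).
Proof.
have t_gt1 : 1 < t by lia.
have kE : k = t.*2 + 2 by move: k_even; lia.
have [n0 upper] := two_connected_free_edges F t_gt1.
(* The join needs two independent vertices besides the [t] others to be 2-connected. *)
exists (maxn n0 (t + 2)) => n; rewrite geq_max => /andP[n0_n t_n].
pose m := ex t (covering_family F) + t * (n - t); pose e2 := ex_2conn n (adjoin (cycles_ge k) F).
have m_e2 : m <= e2.
  have [G0] := exists_EX (empty_free_covering pF).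
  rewrite inE => /andP[/asboolP G0_free /eqP G0_ex].
  rewrite /m -G0_ex; apply: leq_trans (join_edges_card G0 t_n) _.
  apply: (@leq_bigmax_cond _ _ (fun G => #|edges G|)); apply/andP; split.
    exact: join_two_connected.
  apply/asboolP => U H [W H' [c c_ge3 k_c]|]; last exact: join_free.
  by apply: join_no_cycle; rewrite // -addnn; lia.
have e2_m1 : e2 <= m + 1.
  apply/bigmax_leqP => G /andP[G_2c /asboolP]; rewrite kE => G_free.
  have [|[->//]] := upper n n0_n G G_2c G_free.
  by move/leq_trans; apply; apply: leq_addr.
exists (e2 - m); split; first by lia.
split; first by rewrite -/m -/e2; lia.
(* A graph with [m + 1] edges would give an extremal graph on [t] vertices without any [F] minus an
   edge's ends. *)
move=> all_H'; apply/eqP; rewrite subn_eq0; apply/bigmax_leqP => G /andP[G_2c /asboolP].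
rewrite kE => G_free; have [//|[_ [G' /all_H' [U [H [F_H H_G']]] no_H]]] := upper n n0_n G G_2c G_free.
by have := no_H U H F_H H_G'.
Qed.
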